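(* Let $p\ge 2$ and $\lambda>0$. Let $\boldsymbol{X}$ be a random vector taking values in $\mathcal{S}^{p-1}$, with moment generating function $M_{\boldsymbol{X}}(\boldsymbol{t})=\mathbb{E}[e^{\boldsymbol{t}^\top\boldsymbol{X}}]$, $\boldsymbol{t}\in\mathbb{R}^p$. Then $$\mathbb{E}\big[\Delta_{\mathcal{S}^{p-1}}e^{\lambda\boldsymbol{t}^\top\boldsymbol{X}}\big]=\Delta_{\mathcal{S}^{p-1}}M_{\boldsymbol{X}}(\lambda\boldsymbol{t})=0\quad\text{for all }\boldsymbol{t}\in\mathcal{S}^{p-1}$$ if and only if $\boldsymbol{X}$ is uniformly distributed on $\mathcal{S}^{p-1}$.
   Context: $\mathcal{S}^{p-1}=\{\boldsymbol{x}\in\mathbb{R}^p:\|\boldsymbol{x}\|=1\}$ is the unit sphere and $\Delta_{\mathcal{S}^{p-1}}$ is its Laplace--Beltrami operator (the spherical part of the Euclidean Laplacian). $\Delta_{\mathcal{S}^{p-1}}e^{\lambda\boldsymbol{t}^\top\boldsymbol{X}}$ means: apply $\Delta_{\mathcal{S}^{p-1}}$ to the function $\boldsymbol{x}\mapsto e^{\lambda\boldsymbol{t}^\top\boldsymbol{x}}$ on $\mathcal{S}^{p-1}$ and evaluate at $\boldsymbol{x}=\boldsymbol{X}$ (by symmetry of $\boldsymbol{t}^\top\boldsymbol{x}$ this equals the Laplace--Beltrami operator applied in the variable $\boldsymbol{t}\in\mathcal{S}^{p-1}$). $\Delta_{\mathcal{S}^{p-1}}M_{\boldsymbol{X}}(\lambda\boldsymbol{t})$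 means: apply $\Delta_{\mathcal{S}^{p-1}}$ to the function $\boldsymbol{t}\mapsto M_{\boldsymbol{X}}(\lambda\boldsymbol{t})$ on $\mathcal{S}^{p-1}$. *)

(* Defs.v *)
From HB Require Import structures.
From mathcomp Require Import all_boot all_order all_algebra.
From mathcomp Require Import all_classical all_reals all_analysis.
Set Implicit Arguments.
Unset Strict Implicit.
Unset Printing Implicit Defensive.
Import Order.TTheory GRing.Theory Num.Theory.
Import numFieldNormedType.Exports.
Local Open Scope classical_set_scope.
Local Open Scope ring_scope.

(* The library norm `|x| on 'rV[R]_n is the sup norm, hence [enorm]. *)
Definition dot (R : realType) (n : nat) (x y : 'rV[R]_n) : R :=
  \sum_(i < n) x 0 i * y 0 i.

Definition enorm (R : realType) (n : nat) (x : 'rV[R]_n) : R :=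
  Num.sqrt (dot x x).

Definition unit_sphere (R : realType) (n : nat) : set 'rV[R]_n :=
  [set x | enorm x = 1].

Definition laplacian (R : realType) (n : nat) (f : 'rV[R]_n -> R)
    (x : 'rV[R]_n) : R :=
  \sum_(i < n) 'D_(delta_mx 0 i) ('D_(delta_mx 0 i) f) x.

(* In polar coordinates the Euclidean Laplacian is
   d^2/dr^2 + ((n - 1) / r) d/dr + r^-2 Delta_S.  Extending f from the sphere by
   y |-> f (y / |y|), which is constant along rays, removes the radial terms, so
   at a point x with |x| = 1 only Delta_S f x remains.  The value depends only
   on the restriction of f to the unit sphere. *)
Definition laplace_beltrami (R : realType) (n : nat) (f : 'rV[R]_n -> R)
    (x : 'rV[R]_n) : R :=
  laplacian (fun y => f ((enorm y)^-1 *: y)) x.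

(* 'rV[R]_n carries the sigma-algebra generated by the coordinates (the Borel
   sets), as n.-tuple R does in the library. *)
Section measurable_rV.
Variables (R : realType) (n : nat).

Let coors : 'I_n -> 'rV[R]_n -> R := fun i x => x 0 i.

Let rV_set0 : g_sigma_preimage coors set0.
Proof. exact: sigma_algebra0. Qed.

Let rV_setC A : g_sigma_preimage coors A -> g_sigma_preimage coors (~` A).
Proof. exact: sigma_algebraC. Qed.

Let rV_bigcup (F : (set 'rV[R]_n)^nat) :
  (forall i, g_sigma_preimage coors (F i)) ->
  g_sigma_preimage coors (\bigcup_i (F i)).
Proof. exact: sigma_algebra_bigcup. Qed.

HB.instance Definition _ :=
  @isMeasurable.Build (measure_tuple_display default_measure_display)
    'rV[R]_n (g_sigma_preimage coors) rV_set0 rV_setC rV_bigcup.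

End measurable_rV.

(* Lebesgue measure on R^n as an iterated product; R^0 is a single point of
   mass 1, and R^n.+1 is identified with R * R^n by (a, x) |-> row_mx a x. *)
Fixpoint lebesgue_rV (R : realType) (n : nat) : set 'rV[R]_n -> \bar R :=
  match n with
  | 0 => \d_(0 : 'rV[R]_0)
  | m.+1 => pushforward (@lebesgue_measure R \x @lebesgue_rV R m)%E
      (fun ax : measurableTypeR R * 'rV[R]_m =>
         row_mx (const_mx ax.1 : 'rV[R]_1) ax.2 : 'rV[R]_m.+1)
  end.

(* Surface measure of A `&` unit_sphere: since Lebesgue measure is
   r^(n - 1) dr dsigma in polar coordinates, it is n times the volume of the
   cone { r u | 0 < r <= 1, u in A, |u| = 1 }. *)
Definition surface_measure (R : realType) (n : nat) (A : set 'rV[R]_n) :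
    \bar R :=
  (n%:R%:E * lebesgue_rV [set y : 'rV[R]_n |
                (0 < enorm y <= 1)%R /\ A ((enorm y)^-1 *: y)])%E.

Definition uniform_on_sphere d (T : measurableType d) (R : realType)
    (P : probability T R) (n : nat) (X : {RV P >-> 'rV[R]_n}) : Prop :=
  forall A : set 'rV[R]_n, measurable A ->
    distribution P X A =
    (surface_measure A / surface_measure (@unit_sphere R n))%E.

Definition mgf d (T : measurableType d) (R : realType)
    (P : probability T R) (n : nat) (X : {RV P >-> 'rV[R]_n})
    (t : 'rV[R]_n) : \bar R :=
  'E_P[fun w => expR (dot t (X w))]%E.

(* Main.v *)
Require Import Defs.
From HB Require Import structures.
From mathcomp Require Import all_boot all_order all_algebra.
From mathcomp Require Import all_classical all_reals all_analysis.
From mathcomp Require Import measurable_realfun ring lra.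
Set Implicit Arguments.
Unset Strict Implicit.
Unset Printing Implicit Defensive.
Import Order.TTheory GRing.Theory Num.Theory.
Import numFieldNormedType.Exports.
Local Open Scope classical_set_scope.
Local Open Scope ring_scope.

(** The hypothesis controls only a sum over all coordinate planes, whereas invariance is wanted in
    each plane. The sum can be split because every gap [E phi - E (phi o R)] is half the squared
    norm of a difference of two laws, hence nonnegative: a bound on the sum bounds each gap. Since
    that sign is free, a one-sided expansion suffices: [expR u] is only bounded below, by its cubic
    Taylor polynomial. The exponent 3 is what counts. It makes [phi] Hoelder of exponent 3/2 along
    each rotation orbit, and an exponent above 1 forces the derivative to vanish; a bound of order 2
    would only give a Lipschitz function. The Hilbert space itself is never built. Its inner
    products are limits of finite sums over monomials with nonnegative weights, and a law enters
    only through its integration functional, so that Dirac masses, rotated laws and the laws of [X]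
    and [Y] are treated alike. *)

(* Write phi(t) = E exp(lambda t.X) and let k(t.x) be the spherical Laplacian of
   exp(lambda t.x) in t, an expression symmetric in t and x.  Differentiating
   twice under the expectation gives (Laplacian phi)(t) = E k(t.X), so the first
   equality always holds.  The kernel exp(lambda x.y) is positive definite, being
   a series of powers of x.y with positive coefficients, so that laws on the
   sphere can be compared in the norm of its reproducing kernel Hilbert space.
   - If E k(t.X) = 0 on the sphere, then summing over the coordinate planes the
     squared norms between the law of X and its image under a rotation of angle
     theta, the terms of order theta^2 cancel and O(theta^3) is left.  By
     Cauchy-Schwarz, |phi(R t) - phi(t)|^2 = O(theta^3) uniformly in t, so phi is
     constant along rotations, that is, on the sphere.
   - If X and Y both have a transform constant on the sphere, the squared norm of
     the difference of their laws vanishes; all their moments agree, and so do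
     their laws.
   The uniform variable Y is the radial projection of normalized Lebesgue measure
   on the ball; it is rotation invariant because Lebesgue measure is invariant
   under shears and a plane rotation is a product of three shears.  Hence its
   transform is constant on the sphere. *)

(** * The Euclidean structure of row vectors and plane rotations *)

Section measurable_rV.
Context (R : realType) (n : nat).

Lemma measurable_coord (i : 'I_n) : measurable_fun setT (fun x : 'rV[R]_n => x 0 i).
Proof.
move=> _ Y mY; rewrite setTI; apply: sub_sigma_algebra => /=.
rewrite -bigcup_seq/=; exists i => /=; first by rewrite mem_index_enum.
by exists Y => //; rewrite setTI.
Qed.

Lemma measurable_fun_rV d (T : measurableType d) (f : T -> 'rV[R]_n) :
  (forall i, measurable_fun setT (fun t => f t 0 i)) -> measurable_fun setT f.
Proof.
move=> mf; apply: (@measurability _ _ _ _ _ _ (\big[setU/set0]_(i < n)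
    preimage_set_system setT (fun x : 'rV[R]_n => x 0 i) measurable)) => //.
move=> _ [A + <-]; rewrite -bigcup_seq/= => -[i _ [B mB <-]].
rewrite !setTI /=.
by have := mf i measurableT _ mB; rewrite setTI; apply.
Qed.

Lemma measurable_dot (t : 'rV[R]_n) : measurable_fun setT (dot t).
Proof.
apply: measurable_sum => i.
by apply: measurable_funM; [exact: measurable_cst|exact: measurable_coord].
Qed.

Lemma measurable_enorm : measurable_fun setT (@enorm R n).
Proof.
apply: (@measurableT_comp _ _ _ _ _ _ (@Num.sqrt R)).
  exact: continuous_measurable_fun (@sqrt_continuous R).
by apply: measurable_sum => i; apply: measurable_funM; exact: measurable_coord.
Qed.

End measurable_rV.

Section euclidean.
Context (R : realType) (n : nat).
Implicit Types x y : 'rV[R]_n.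

Lemma dotC x y : dot x y = dot y x.
Proof. by apply: eq_bigr => i _; rewrite mulrC. Qed.

Lemma dotDl x y z : dot (x + y) z = dot x z + dot y z.
Proof. by rewrite /dot -big_split; apply: eq_bigr => i _; rewrite mxE mulrDl. Qed.

Lemma dotZl a x y : dot (a *: x) y = a * dot x y.
Proof. by rewrite /dot mulr_sumr; apply: eq_bigr => i _; rewrite mxE mulrA. Qed.

Lemma dotDr x y z : dot z (x + y) = dot z x + dot z y.
Proof. by rewrite dotC dotDl !(dotC z). Qed.

Lemma dotZr a x y : dot y (a *: x) = a * dot y x.
Proof. by rewrite dotC dotZl dotC. Qed.

Lemma dot_delta (x : 'rV[R]_n) (i : 'I_n) : dot x (delta_mx 0 i) = x 0 i.
Proof.
rewrite /dot (bigD1 i)//= big1 ?addr0 ?mxE ?eqxx ?mulr1// => j ji.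
by rewrite mxE (negbTE ji) andbF mulr0.
Qed.

Lemma dot_ge0 x : 0 <= dot x x.
Proof. by apply: sumr_ge0 => i _; rewrite -expr2 sqr_ge0. Qed.

Lemma enorm_ge0 x : 0 <= enorm x.
Proof. exact: sqrtr_ge0. Qed.

Lemma sqr_enorm x : enorm x ^+ 2 = dot x x.
Proof. by rewrite sqr_sqrtr// dot_ge0. Qed.

Lemma dot_eq0 x : (dot x x == 0) = (x == 0).
Proof.
apply/idP/eqP => [|->]; last first.
  by rewrite /dot big1// => i _; rewrite !mxE mul0r.
rewrite psumr_eq0 => [|i _]; last by rewrite -expr2 sqr_ge0.
move/allP => h; apply/rowP => i; rewrite mxE.
by have := h i (mem_index_enum _); rewrite /= -expr2 sqrf_eq0 => /eqP.
Qed.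

Lemma enorm_eq0 x : (enorm x == 0) = (x == 0).
Proof. by rewrite -dot_eq0 -sqr_enorm sqrf_eq0. Qed.

Lemma enorm_gt0 x : (0 < enorm x) = (x != 0).
Proof. by rewrite lt_neqAle enorm_ge0 andbT eq_sym enorm_eq0. Qed.

Lemma unit_sphereE x : unit_sphere x <-> dot x x = 1.
Proof.
rewrite /unit_sphere/= -sqr_enorm; split=> [->|]; first by rewrite expr1n.
by move/eqP; rewrite sqrf_eq1 => /orP[/eqP//|/eqP h]; have := enorm_ge0 x; rewrite h; lra.
Qed.

Lemma enormZ a x : enorm (a *: x) = `|a| * enorm x.
Proof.
by rewrite /enorm dotZl dotZr mulrA -expr2 sqrtrM ?sqr_ge0// sqrtr_sqr.
Qed.

Lemma unit_sphere_normalize x : x != 0 -> unit_sphere ((enorm x)^-1 *: x).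
Proof.
rewrite -enorm_gt0 => x0; rewrite /unit_sphere/= enormZ gtr0_norm ?invr_gt0//.
by rewrite mulVf ?gt_eqF.
Qed.

Lemma sqr_coord_le1 x i : unit_sphere x -> x 0 i ^+ 2 <= 1.
Proof.
move/unit_sphereE => <-; rewrite /dot (bigD1 i)//= expr2 lerDl.
by apply: sumr_ge0 => j _; rewrite -expr2 sqr_ge0.
Qed.

Lemma norm_coord_le1 x i : unit_sphere x -> `|x 0 i| <= 1.
Proof. by move/sqr_coord_le1 => /(_ i); rewrite -[X in X <= _]real_normK ?num_real// expr_le1. Qed.

Lemma norm_dot_le1 x y : unit_sphere x -> unit_sphere y -> `|dot x y| <= 1.
Proof.
move=> /unit_sphereE x1 /unit_sphereE y1.
have := dot_ge0 (x - y); have := dot_ge0 (x + y).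
rewrite !(dotDl, dotDr) -scaleN1r !(dotZl, dotZr) (dotC y x) x1 y1 => h1 h2.
by rewrite ler_norml; lra.
Qed.

(** The pair [(c, s)] is kept algebraic; an angle appears only in [plane_rotD], where the rotations
    of one plane form a one-parameter group. *)
Definition plane_rot (i j : 'I_n) (c s : R) (x : 'rV[R]_n) : 'rV[R]_n :=
  \row_k if k == i then c * x 0 i - s * x 0 j else
         if k == j then s * x 0 i + c * x 0 j else x 0 k.

(** This form separates the symmetric part, with coefficient [c - 1] of second order in the angle,
    from the skew part of first order, as the Taylor expansion of the kernel requires. *)
Lemma dot_plane_rotl i j c s x y : i != j -> dot (plane_rot i j c s x) y =
  dot x y + (c - 1) * (x 0 i * y 0 i + x 0 j * y 0 j)
    + s * (x 0 i * y 0 j - x 0 j * y 0 i).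
Proof.
move=> ij; rewrite /dot (bigD1 i)//= [in RHS](bigD1 i)//=.
rewrite (bigD1 j) 1?eq_sym//= [in RHS](bigD1 j) 1?eq_sym//=.
rewrite !mxE !eqxx eq_sym (negbTE ij).
rewrite (eq_bigr (fun k => x 0 k * y 0 k)); first by ring.
by move=> k /andP[/negbTE ki /negbTE kj]; rewrite mxE ki kj.
Qed.

(** The transpose of a plane rotation is the rotation with the two indices exchanged. *)
Lemma dot_plane_rotC i j c s x y : i != j ->
  dot (plane_rot i j c s x) y = dot x (plane_rot j i c s y).
Proof.
by move=> ij; rewrite (dotC x) !dot_plane_rotl// 1?eq_sym// (dotC y x); ring.
Qed.

Lemma dot_plane_rot i j c s x y : i != j -> c ^+ 2 + s ^+ 2 = 1 ->
  dot (plane_rot i j c s x) (plane_rot i j c s y) = dot x y.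
Proof.
move=> ij cs; rewrite dot_plane_rotl// (dotC x) dot_plane_rotl// (dotC y) !mxE !eqxx.
rewrite [j == i]eq_sym (negbTE ij).
apply/eqP; rewrite -subr_eq0; set z := (X in X == 0).
have -> : z = (c ^+ 2 + s ^+ 2 - 1) * (x 0 i * y 0 i + x 0 j * y 0 j).
  by rewrite /z; ring.
by rewrite cs subrr mul0r.
Qed.

Lemma unit_sphere_plane_rot i j c s x : i != j -> c ^+ 2 + s ^+ 2 = 1 ->
  unit_sphere x -> unit_sphere (plane_rot i j c s x).
Proof. by move=> ij cs /unit_sphereE x1; apply/unit_sphereE; rewrite dot_plane_rot. Qed.

Lemma plane_rotZ i j c s a x : plane_rot i j c s (a *: x) = a *: plane_rot i j c s x.
Proof. by apply/rowP => k; rewrite !mxE; case: ifP => _; [|case: ifP => _]; ring. Qed.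

Lemma plane_rotD i j a b x : i != j -> plane_rot i j (cos (a + b)) (sin (a + b)) x =
  plane_rot i j (cos a) (sin a) (plane_rot i j (cos b) (sin b) x).
Proof.
move=> ij; apply/rowP => k; rewrite !mxE !eqxx [j == i]eq_sym (negbTE ij) cosD sinD.
by case: ifP => _; [|case: ifP => _]; ring.
Qed.

Lemma plane_rot0 i j x : plane_rot i j 1 0 x = x.
Proof.
apply/rowP => k; rewrite !mxE.
by case: eqP => [->|_]; [ring|case: eqP => [->|_]; ring].
Qed.

Lemma measurable_plane_rot i j c s : measurable_fun setT (plane_rot i j c s).
Proof.
apply: measurable_fun_rV => k; under eq_fun do rewrite mxE.
have [_|_] := eqVneq k i; last have [_|_] := eqVneq k j.
- by apply: measurable_funB; apply: measurable_funM => //; exact: measurable_coord.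
- by apply: measurable_funD; apply: measurable_funM => //; exact: measurable_coord.
- exact: measurable_coord.
Qed.

End euclidean.

(* Coordinate rotations zero the entries of [t] one at a time, leaving [+- e_0]. *)
Lemma plane_rot_invariant_cst (R : realType) (n : nat) (phi : 'rV[R]_n.+2 -> R) :
  (forall (j : 'I_n.+2) c s t, j != 0 -> c ^+ 2 + s ^+ 2 = 1 -> unit_sphere t ->
    phi (plane_rot 0 j c s t) = phi t) ->
  forall t u, unit_sphere t -> unit_sphere u -> phi t = phi u.
Proof.
move=> phirot.
suff H t : unit_sphere t -> phi t = phi (delta_mx 0 0).
  by move=> t u /H -> /H ->.
move=> t1.
have [v [v1 <- v0]] : exists v, [/\ unit_sphere v, phi v = phi t &
    forall j : 'I_n.+2, j != 0 -> v 0 j = 0].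
  suff /(_ n.+2)[v [v1 pv v0]] : forall m, exists v, [/\ unit_sphere v, phi v = phi t &
      forall j : 'I_n.+2, j != 0 -> (j < m)%N -> v 0 j = 0].
    by exists v; split => // j j0; exact: v0.
  elim=> [|k [v [v1 <- v0]]]; first by exists t; split.
  have [kn|kn] := ltnP k n.+2; last first.
    by exists v; split => // j j0 _; apply: v0 => //; apply: leq_trans kn.
  have [k0|k0] := eqVneq k 0%N.
    by exists v; split => // j j0; rewrite k0 ltnS leqn0 => /eqP jE; case/eqP: j0; exact/val_inj.
  pose j := Ordinal kn; have j0 : j != 0 by apply: contra k0 => /eqP/(congr1 val)/= ->.
  (* The rotation chosen below takes [(v_0, v_j)] to [(sqrt q, 0)] and fixes the coordinates already
     cleared. If [q = 0], the entry [v_j] is zero from the start. *)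
  pose q := v 0 0 ^+ 2 + v 0 j ^+ 2.
  have [q0|q0] := eqVneq q 0.
    exists v; split => // i i0; rewrite ltnS leq_eqVlt => /orP[/eqP ik|]; last exact: v0.
    have -> : i = j by exact/val_inj.
    apply/eqP; rewrite -sqrf_eq0; move/eqP: q0; rewrite paddr_eq0 ?sqr_ge0//.
    by case/andP.
  have qp : 0 < q by rewrite lt_neqAle eq_sym q0 addr_ge0 ?sqr_ge0.
  have sq : Num.sqrt q ^+ 2 = q by rewrite sqr_sqrtr ?ltW.
  have sq0 : Num.sqrt q != 0 by rewrite gt_eqF// sqrtr_gt0.
  have cs : (v 0 0 / Num.sqrt q) ^+ 2 + (- (v 0 j / Num.sqrt q)) ^+ 2 = 1.
    by rewrite sqrrN !expr_div_n sq -mulrDl divff.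
  exists (plane_rot 0 j (v 0 0 / Num.sqrt q) (- (v 0 j / Num.sqrt q)) v); split.
  - by apply: unit_sphere_plane_rot => //; rewrite eq_sym.
  - by rewrite phirot.
  - move=> i i0; rewrite ltnS leq_eqVlt mxE (negbTE i0) => /orP[/eqP ik|ik].
      have -> : i = j by exact/val_inj.
      by rewrite eqxx; field.
    have ij : i != j by apply: contraTneq ik => ->; rewrite ltnn.
    by rewrite (negbTE ij) v0.
have vE : v = v 0 0 *: delta_mx 0 0.
  apply/rowP => i; rewrite !mxE /=; have [->|i0] := eqVneq i 0; first by rewrite mulr1.
  by rewrite mulr0 v0.
have : v 0 0 ^+ 2 = 1.
  move/unit_sphereE: v1; rewrite {1}vE dotZl dotC dot_delta => <-.
  by rewrite expr2.
move/eqP; rewrite sqrf_eq1 => /orP[] /eqP v00; first by rewrite vE v00 scale1r.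
(* A half turn in the plane of the coordinates 0 and 1 exchanges [- e_0] and [e_0]; a second
   coordinate must exist for this, whence the dimension [n.+2]. *)
rewrite -(phirot 1 (-1) 0 v)//; last by rewrite sqrrN expr1n expr0n addr0.
congr phi; apply/rowP => i; rewrite !mxE /=.
have [_|i0] := eqVneq i 0; first by rewrite v00 mulrNN mulr1 mul0r subr0.
have [_|i1] := eqVneq i 1; first by rewrite (v0 1)// mul0r mulr0 addr0.
by rewrite v0.
Qed.

(** * Lebesgue measure on row vectors *)

Section cons_rV.
Context (R : realType) (m : nat).

Definition cons_rV (ax : measurableTypeR R * 'rV[R]_m) : 'rV[R]_m.+1 :=
  row_mx (const_mx ax.1 : 'rV[R]_1) ax.2.

Definition tail_rV (x : 'rV[R]_m.+1) : 'rV[R]_m := \row_j x 0 (lift 0 j).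

Lemma cons_rV0 ax : cons_rV ax 0 0 = ax.1.
Proof.
have -> : (0 : 'I_m.+1) = lshift m (0 : 'I_1) by exact/val_inj.
by rewrite (row_mxEl (const_mx ax.1 : 'rV[R]_1)) mxE.
Qed.

Lemma cons_rVS ax j : cons_rV ax 0 (lift 0 j) = ax.2 0 j.
Proof.
have -> : (lift 0 j : 'I_m.+1) = rshift 1 j by exact/val_inj.
by rewrite (row_mxEr (const_mx ax.1 : 'rV[R]_1)).
Qed.

Lemma measurable_tail_rV : measurable_fun setT tail_rV.
Proof.
apply: measurable_fun_rV => i; under eq_fun do rewrite mxE.
exact: measurable_coord.
Qed.

Lemma measurable_cons_rV : measurable_fun setT cons_rV.
Proof.
apply: measurable_fun_rV => i.
case: (unliftP 0 i) => [j|] ->.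
  under eq_fun do rewrite cons_rVS.
  exact: (@measurableT_comp _ _ _ _ _ _ (fun y : 'rV[R]_m => y 0 j) _ _
    (@measurable_coord R m j) measurable_snd).
by under eq_fun do rewrite cons_rV0; exact: measurable_fst.
Qed.

End cons_rV.

Lemma measurable_box (R : realType) n (I : set (measurableTypeR R)) : measurable I ->
  measurable [set x : 'rV[R]_n | forall i, I (x 0 i)].
Proof.
move=> mI; rewrite (_ : [set _ | _] = \bigcap_(i in setT) ((fun x : 'rV[R]_n => x 0 i) @^-1` I)).
  apply: fin_bigcap_measurable => // i _.
  by rewrite -[X in measurable X]setTI; exact: measurable_coord.
by apply/seteqP; split => [x h i _|x h i]; [exact: h|exact: (h i Logic.I)].
Qed.

Lemma sigma_finite_boxes (R : realType) n (mu : {measure set 'rV[R]_n -> \bar R}) :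
  (forall k : nat, mu [set x | forall i, `[- k%:R, k%:R]%classic (x ord0 i)]%R < +oo)%E ->
  sigma_finite setT mu.
Proof.
move=> muoo; exists (fun k : nat => [set x : 'rV[R]_n | forall i, `[- k%:R, k%:R]%classic (x 0 i)]).
  apply/seteqP; split => // x _.
  exists (Num.bound (\sum_i `|x 0 i|)) => // i /=.
  rewrite in_itv/= -ler_norml (le_trans _ (ltW (archi_boundP _)))//; last exact: sumr_ge0.
  by rewrite (bigD1 i)//= lerDl sumr_ge0.
move=> k; split; last exact: muoo.
by apply: measurable_box; exact: measurable_itv.
Qed.

(** [lebesgue_rV] is a bare set function. That it is a measure in dimension [n.+1] follows from
    sigma-finiteness in dimension [n], and sigma-finiteness comes from the finite mass of cubes, so
    both facts go through one induction. *)
Lemma lebesgue_rV_sigma_finite_box (R : realType) (n : nat) :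
  (exists mu : {sigma_finite_measure set 'rV[R]_n -> \bar R},
    mu = @lebesgue_rV R n :> (set 'rV[R]_n -> \bar R)) /\
  (forall (I : set (measurableTypeR R)) (r : R), measurable I ->
    lebesgue_measure I = r%:E ->
    lebesgue_rV [set x : 'rV[R]_n | forall i, I (x 0 i)] = (r ^+ n)%:E).
Proof.
elim: n => [|n [[mu muE] IH]].
  split; first by exists (\d_(0 : 'rV[R]_0)).
  by move=> I r _ _; rewrite /= diracE mem_set//= => -[].
have box I r : measurable I -> lebesgue_measure I = r%:E ->
    lebesgue_rV [set x : 'rV[R]_n.+1 | forall i, I (x 0 i)] = (r ^+ n.+1)%:E.
  move=> mI Ir; rewrite /= /pushforward -muE.
  rewrite (_ : _ @^-1` _ = I `*` [set x : 'rV[R]_n | forall i, I (x 0 i)]).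
    rewrite product_measure1E//; last exact: measurable_box.
    rewrite [X in (_ * X)%E](_ : _ = (r ^+ n)%:E); last by rewrite muE (IH I r).
    by rewrite [X in (X * _)%E](_ : _ = r%:E)// -EFinM exprS.
  apply/seteqP; split => [[a x]/= h|[a x]/= [Ia Ix] i].
    split; first by have := h 0; rewrite -/(cons_rV (a, x)) cons_rV0.
    by move=> i; have := h (lift 0 i); rewrite -/(cons_rV (a, x)) cons_rVS.
  by rewrite -/(cons_rV (a, x)); case: (unliftP 0 i) => [j|] ->; rewrite ?cons_rVS ?cons_rV0.
split => //.
pose prd : {measure set (measurableTypeR R * 'rV[R]_n)%type -> \bar R} :=
  (@lebesgue_measure R \x mu)%E.
pose M := measure_function_pushforward__canonical__measure_function_Measure
  prd (@measurable_cons_rV R n).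
have ME : M = @lebesgue_rV R n.+1 :> (set _ -> \bar R) by rewrite /= -muE.
have sf : sigma_finite setT M.
  apply: sigma_finite_boxes => k; rewrite [X in (X < _)%E](_ : _ = ((k%:R + k%:R) ^+ n.+1)%:E) ?ltry//.
  rewrite ME; apply: box; first exact: measurable_itv.
  rewrite lebesgue_measure_itv/= lte_fin; case: ltP => kk; first by rewrite -EFinB opprK.
  by congr EFin; have := ler0n R k; move: kk; lra.
pose S := Measure_isSigmaFinite.Build _ _ _ M sf.
pose N : {sigma_finite_measure set 'rV[R]_n.+1 -> \bar R} := HB.pack (Measure.sort M) (Measure.class M) S.
by exists N.
Qed.

Lemma lebesgue_rV_sigma_finite (R : realType) (n : nat) :
  exists mu : {sigma_finite_measure set 'rV[R]_n -> \bar R},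
    mu = @lebesgue_rV R n :> (set 'rV[R]_n -> \bar R).
Proof. by have [] := lebesgue_rV_sigma_finite_box R n. Qed.

Section lebesgue_rV_sections.
Local Open Scope ereal_scope.
Context (R : realType) (m : nat).
Implicit Type A : set 'rV[R]_m.+1.

Lemma measurable_cons_preimage A : measurable A ->
  measurable ((@cons_rV R m) @^-1` A).
Proof. by move=> mA; rewrite -[X in measurable X]setTI; exact: measurable_cons_rV. Qed.

Lemma measurable_cons_section A a : measurable A ->
  measurable [set y : 'rV[R]_m | A (cons_rV (a, y))].
Proof.
move=> /measurable_cons_preimage/(measurable_xsection a).
by congr measurable; apply/seteqP; split => y; rewrite /xsection/= inE.
Qed.

Lemma lebesgue_rVSl A : lebesgue_rV A =
  \int[@lebesgue_measure R]_a lebesgue_rV [set y : 'rV[R]_m | A (cons_rV (a, y))].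
Proof.
rewrite /= /pushforward /product_measure1; apply: eq_integral => a _ /=.
by congr lebesgue_rV; apply/seteqP; split => y; rewrite /xsection/= inE.
Qed.

Lemma measurable_fun_lebesgue_section A : measurable A ->
  measurable_fun setT (fun a : measurableTypeR R =>
    lebesgue_rV [set y : 'rV[R]_m | A (cons_rV (a, y))]).
Proof.
move=> /measurable_cons_preimage mA.
have [mu muE] := @lebesgue_rV_sigma_finite R m.
have := @measurable_fun_xsection _ _ _ _ _ mu _ mA.
rewrite muE; congr measurable_fun; apply/funext => a /=.
by congr lebesgue_rV; apply/seteqP; split => y; rewrite /xsection/= inE.
Qed.

(** Tonelli's theorem: the order opposite to that of the definition, needed for maps that move only
    the first coordinate. *)
Lemma lebesgue_rVSr A : measurable A -> lebesgue_rV A =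
  \int[@lebesgue_rV R m]_y lebesgue_measure [set a : R | A (cons_rV (a, y))].
Proof.
move=> /measurable_cons_preimage mA.
have [mu muE] := @lebesgue_rV_sigma_finite R m.
rewrite /= /pushforward -muE.
rewrite (product_measure_unique (m' := (@lebesgue_measure R \x^ mu)))//; last first.
  by move=> B C mB mC; exact: product_measure2E.
rewrite /product_measure2; apply: eq_integral => a _ /=.
by congr lebesgue_measure; apply/seteqP; split => y; rewrite /ysection/= inE.
Qed.

End lebesgue_rV_sections.

(** * Translation invariance of Lebesgue measure *)

Section translation.
Context (R : realType).

Lemma lebesgue_measure_shift (a : R) (A : set (measurableTypeR R)) : measurable A ->
  lebesgue_measure [set x : R | A (x + a)] = lebesgue_measure A.
Proof.
pose f : measurableTypeR R -> measurableTypeR R := fun x : R => x + a.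
have mf : measurable_fun setT f by apply: measurable_funD.
pose M := measure_function_pushforward__canonical__measure_function_Measure
  (@lebesgue_measure R) mf.
move=> mA; symmetry; apply: (lebesgue_measure_unique (mu := M)) => // X [[u v] /= uv <-].
rewrite /M /= /pushforward /f.
rewrite (_ : _ @^-1` _ = [set` `]u - a, v - a]]); last first.
  by apply/seteqP; split => x /=; rewrite !in_itv/= ltrBlDr lerBrDr.
by rewrite !lebesgue_measure_itv/= !lte_fin ltrD2r -!EFinB; congr (if _ then _%:E else _); ring.
Qed.

Lemma ge0_integral_shift (a : R) (f : measurableTypeR R -> \bar R) :
  measurable_fun setT f -> (forall x, 0 <= f x)%E ->
  (\int[@lebesgue_measure R]_x f (x + a)%R = \int[@lebesgue_measure R]_x f x)%E.
Proof.
move=> mf f0.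
pose g : measurableTypeR R -> measurableTypeR R := fun x : R => x + a.
have mg : measurable_fun setT g by apply: measurable_funD.
have := @ge0_integral_pushforward _ _ _ _ R g mg (@lebesgue_measure R) setT f measurableT mf.
rewrite preimage_setT => <-; last by move=> *; exact: f0.
apply: eq_measure_integral => A mA _.
by rewrite [LHS]lebesgue_measure_shift.
Qed.

Lemma lebesgue_rV_translate n (v : 'rV[R]_n) (A : set 'rV[R]_n) : measurable A ->
  lebesgue_rV [set x | A (x + v)] = lebesgue_rV A.
Proof.
elim: n v A => [|n IH] v A mA.
  congr lebesgue_rV; apply/seteqP; split => x /=; suff -> : x + v = x by [].
    by apply/rowP => -[].
  by apply/rowP => -[].
have consD a y : cons_rV (a, y) + v = cons_rV (a + v 0 0, y + tail_rV v).
  apply/rowP => i; rewrite mxE; case: (unliftP 0 i) => [j|] ->.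
    by rewrite !cons_rVS !mxE.
  by rewrite !cons_rV0.
rewrite !lebesgue_rVSl.
rewrite -(@ge0_integral_shift (v 0 0) (fun a => lebesgue_rV [set y : 'rV[R]_n | A (cons_rV (a, y))])).
- apply: eq_integral => a _ /=.
  rewrite -(IH (tail_rV v) _ (measurable_cons_section (a + v 0 0) mA)).
  by congr lebesgue_rV; apply/seteqP; split => y /=; rewrite consD.
- exact: measurable_fun_lebesgue_section.
- by move=> a; have [mu <-] := @lebesgue_rV_sigma_finite R n.
Qed.

End translation.

(** * Invariance of Lebesgue measure under shears and plane rotations *)

Section shears.
Context (R : realType) (m : nat).
Implicit Type A : set 'rV[R]_m.+1.

Definition shear_tail (v : 'rV[R]_m) (x : 'rV[R]_m.+1) : 'rV[R]_m.+1 :=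
  cons_rV (x 0 0, tail_rV x + x 0 0 *: v).

Definition shear_head (c : 'rV[R]_m) (x : 'rV[R]_m.+1) : 'rV[R]_m.+1 :=
  cons_rV (x 0 0 + dot c (tail_rV x), tail_rV x).

Lemma tail_cons_rV ax : tail_rV (@cons_rV R m ax) = ax.2.
Proof. by apply/rowP => j; rewrite mxE cons_rVS. Qed.

Lemma measurable_cons2 (f : 'rV[R]_m.+1 -> measurableTypeR R) (g : 'rV[R]_m.+1 -> 'rV[R]_m) :
  measurable_fun setT f -> measurable_fun setT g ->
  measurable_fun setT (fun x => cons_rV (f x, g x)).
Proof.
move=> mf mg; apply: (measurableT_comp (@measurable_cons_rV R m)).
exact: measurable_fun_pair.
Qed.

Lemma measurable_shear_tail v : measurable_fun setT (shear_tail v).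
Proof.
apply: measurable_cons2; first exact: measurable_coord.
apply: measurable_fun_rV => i; under eq_fun do rewrite !mxE.
apply: measurable_funD; first exact: measurable_coord.
by apply: measurable_funM => //; exact: measurable_coord.
Qed.

Lemma measurable_shear_head c : measurable_fun setT (shear_head c).
Proof.
apply: measurable_cons2; last exact: measurable_tail_rV.
apply: measurable_funD; first exact: measurable_coord.
exact: measurableT_comp (measurable_dot c) (@measurable_tail_rV R m).
Qed.

(** For a fixed first coordinate the shear is a translation of the section. *)
Lemma lebesgue_rV_shear_tail v A : measurable A ->
  lebesgue_rV (shear_tail v @^-1` A) = lebesgue_rV A.
Proof.
move=> mA; rewrite !lebesgue_rVSl; apply: eq_integral => a _.
rewrite -(lebesgue_rV_translate (a *: v) (measurable_cons_section a mA)).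
congr lebesgue_rV; apply/seteqP; split => y /=;
  by rewrite /shear_tail cons_rV0 tail_cons_rV.
Qed.

(** For a fixed tail the shear is a translation of the line, so the integration is done over the
    tail last. *)
Lemma lebesgue_rV_shear_head c A : measurable A ->
  lebesgue_rV (shear_head c @^-1` A) = lebesgue_rV A.
Proof.
move=> mA; have mcA : measurable (shear_head c @^-1` A).
  by rewrite -[X in measurable X]setTI; exact: measurable_shear_head.
rewrite !lebesgue_rVSr//; have [mu <-] := @lebesgue_rV_sigma_finite R m.
apply: eq_integral => y _.
have mAy : measurable [set a : measurableTypeR R | A (cons_rV (a, y))].
  have := measurable_ysection y (measurable_cons_preimage mA).
  by congr measurable; apply/seteqP; split => a; rewrite /ysection/= inE.
rewrite -(lebesgue_measure_shift (dot c y) mAy).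
congr lebesgue_measure; apply/seteqP; split => a /=;
  by rewrite /shear_head cons_rV0 tail_cons_rV.
Qed.

(* A rotation of angle [theta] is the composition of three shears, of parameters
   [- tan (theta / 2)], [sin theta] and [- tan (theta / 2)]. *)
Lemma plane_rot_shears (j : 'I_m) c s x : 1 + c != 0 -> c ^+ 2 + s ^+ 2 = 1 ->
  plane_rot 0 (lift 0 j) c s x =
  shear_head (- (s / (1 + c)) *: delta_mx 0 j)
    (shear_tail (s *: delta_mx 0 j)
      (shear_head (- (s / (1 + c)) *: delta_mx 0 j) x)).
Proof.
move=> c1 cs; have s2 : s ^+ 2 = (1 - c) * (1 + c).
  by rewrite -[LHS](addKr (c ^+ 2)) cs; ring.
rewrite /shear_head /shear_tail !dotZl ![dot (delta_mx _ _) _]dotC !dot_delta.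
rewrite !tail_cons_rV !cons_rV0 /=; apply/rowP => i.
case: (unliftP 0 i) => [k|] ->.
  rewrite cons_rVS !mxE /= (inj_eq lift_inj) eq_sym.
  have [->|_] := eqVneq k j; last by rewrite !mulr0 addr0.
  rewrite !mulr1; apply/eqP; rewrite -subr_eq0; apply/eqP.
  transitivity (x 0 (lift 0 j) * (c - 1 + s ^+ 2 / (1 + c))).
    by field.
  by rewrite s2 mulfK//; ring.
rewrite cons_rV0 !mxE !eqxx /=.
apply/eqP; rewrite -subr_eq0; apply/eqP.
transitivity ((x 0 0 - s / (1 + c) * x 0 (lift 0 j)) * (c - 1 + s ^+ 2 / (1 + c))).
  by field.
by rewrite s2 mulfK//; ring.
Qed.

Lemma lebesgue_rV_plane_rot_aux (j : 'I_m) c s A : 1 + c != 0 -> c ^+ 2 + s ^+ 2 = 1 ->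
  measurable A -> lebesgue_rV (plane_rot 0 (lift 0 j) c s @^-1` A) = lebesgue_rV A.
Proof.
move=> c1 cs mA; set u := - (s / (1 + c)) *: delta_mx 0 j : 'rV[R]_m.
have -> : plane_rot 0 (lift 0 j) c s @^-1` A =
    shear_head u @^-1` (shear_tail (s *: delta_mx 0 j) @^-1` (shear_head u @^-1` A)).
  by apply/seteqP; split => x /=; rewrite plane_rot_shears.
have m1 : measurable (shear_head u @^-1` A).
  by rewrite -[X in measurable X]setTI; exact: measurable_shear_head.
rewrite lebesgue_rV_shear_head; last first.
  by rewrite -[X in measurable X]setTI; exact: measurable_shear_tail.
by rewrite lebesgue_rV_shear_tail// lebesgue_rV_shear_head.
Qed.

Lemma lebesgue_rV_plane_rot (j : 'I_m.+1) c s A : j != 0 -> c ^+ 2 + s ^+ 2 = 1 ->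
  measurable A -> lebesgue_rV (plane_rot 0 j c s @^-1` A) = lebesgue_rV A.
Proof.
case: (unliftP 0 j) => [k|] -> // j0 cs mA.
have [c1|] := eqVneq (1 + c) 0; last by move=> c1; exact: lebesgue_rV_plane_rot_aux.
have cE : c = -1 by apply/eqP; rewrite -addr_eq0 addrC c1.
have s0 : s = 0.
  by apply/eqP; rewrite -sqrf_eq0 -[s ^+ 2](addKr (c ^+ 2)) cs cE sqrrN expr1n addNr.
(* The shear parameter [s / (1 + c)] breaks down exactly for the half turn, which is therefore
   written as two quarter turns. *)
have -> : plane_rot 0 (lift 0 k) c s @^-1` A =
    plane_rot 0 (lift 0 k) 0 1 @^-1` (plane_rot 0 (lift 0 k) 0 1 @^-1` A).
  rewrite -comp_preimage; congr (_ @^-1` A); apply/funext => x /=.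
  apply/rowP => i; rewrite !mxE !eqxx (negbTE j0) /= cE s0; case: ifP => _; first by ring.
  by case: ifP => _ //; ring.
have c01 : (0 : R) ^+ 2 + 1 ^+ 2 = 1 by rewrite expr0n expr1n add0r.
have n10 : 1 + 0 != 0 :> R by rewrite addr0 oner_neq0.
rewrite !lebesgue_rV_plane_rot_aux//.
by rewrite -[X in measurable X]setTI; exact: measurable_plane_rot.
Qed.

End shears.

(** * The uniform distribution on the sphere *)

Lemma mnormalizeE d (T : measurableType d) (R : realType)
    (mu : {measure set T -> \bar R}) (P : probability T R) (v : R) (A : set T) :
  mu setT = v%:E -> v != 0 -> mnormalize mu P A = (mu A * (v^-1)%:E)%E.
Proof. by move=> muT v0; rewrite /mnormalize muT eqe (negbTE v0). Qed.

Section uniform_variable.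
Context (R : realType) (n : nat).
Notation V := 'rV[R]_n.+1.

Definition punctured_ball : set V := [set y | 0 < enorm y <= 1].

(** The value at the origin is a point of the sphere, so that the uniform variable lies on the
    sphere at every outcome. *)
Definition normalize (y : V) : V :=
  if enorm y == 0 then delta_mx 0 0 else (enorm y)^-1 *: y.

Lemma unit_sphere_normalize0 y : unit_sphere (normalize y).
Proof.
rewrite /normalize; case: eqVneq => [_|y0].
  by apply/unit_sphereE; rewrite dot_delta mxE eqxx.
by apply: unit_sphere_normalize; rewrite -enorm_eq0.
Qed.

Lemma measurable_normalize : measurable_fun setT normalize.
Proof.
apply: measurable_fun_rV => i.
(* The inverse of the norm is written as a power to apply [measurable_powR]. *)
rewrite (_ : (fun _ => _) = fun y => if enorm y == 0 then (delta_mx 0 0 : V) 0 i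
    else powR (enorm y) (-1) * y 0 i); last first.
  apply/funext => y; rewrite /normalize; case: ifP => _ //.
  by rewrite mxE powR_inv1// enorm_ge0.
apply: measurable_fun_ifT => //.
- apply: measurable_fun_eqr => //; exact: measurable_enorm.
- apply: measurable_funM; last exact: measurable_coord.
  apply: (@measurableT_comp _ _ _ _ _ _ (fun x : R => powR x (-1))).
    exact: measurable_powR.
  exact: measurable_enorm.
Qed.

Lemma measurable_punctured_ball : measurable punctured_ball.
Proof.
rewrite (_ : punctured_ball = @enorm R n.+1 @^-1` `]0, 1]).
  by rewrite -[X in measurable X]setTI; apply: measurable_enorm => //; exact: measurable_itv.
by apply/seteqP; split => y; rewrite /punctured_ball/= in_itv.
Qed.

Lemma punctured_ball_fin : exists2 v : R, 0 < v & lebesgue_rV punctured_ball = v%:E.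
Proof.
have [mu muE] := @lebesgue_rV_sigma_finite R n.+1.
have [_ box] := @lebesgue_rV_sigma_finite_box R n.+1.
(* The cube []0, c]^(n+1)] lies in the ball, as each square is at most [c] and there are [n.+1] of
   them; it is open on the left to avoid the origin. *)
pose c : R := n.+1%:R^-1.
have c0 : 0 < c by rewrite invr_gt0.
have c1 : c <= 1 by rewrite invf_le1// ler1n.
have lo : ((c ^+ n.+1)%:E <= lebesgue_rV punctured_ball)%E.
  rewrite -(box `]0, c]%classic); first last.
  - by rewrite lebesgue_measure_itv/= lte_fin c0 -EFinB subr0.
  - exact: measurable_itv.
  rewrite -muE; apply: le_measure; rewrite ?inE.
  - by apply: measurable_box; exact: measurable_itv.
  - exact: measurable_punctured_ball.
  move=> x /= x01; have x0 i : 0 < x 0 i by have := x01 i; rewrite in_itv/= => /andP[].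
  have xc i : x 0 i <= c by have := x01 i; rewrite in_itv/= => /andP[].
  apply/andP; split.
    by rewrite enorm_gt0; apply: contraTneq (x0 0) => ->; rewrite mxE ltxx.
  rewrite -[leRHS]sqrtr1 ler_sqrt// /dot.
  apply: (@le_trans _ _ (\sum_(i < n.+1) c)); last first.
    by rewrite sumr_const card_ord -mulr_natl divff.
  apply: ler_sum => i _; rewrite -[leRHS]mulr1.
  by apply: ler_pM; rewrite ?(ltW (x0 i)) ?xc// (le_trans (xc i)).
have hi : (lebesgue_rV punctured_ball <= (2 ^+ n.+1)%:E)%E.
  rewrite -(box `[(-1), 1]%classic); first last.
  - have n11 : -1 < 1 :> R by lra.
    by rewrite lebesgue_measure_itv/= lte_fin n11 -EFinB opprK.
  - exact: measurable_itv.
  rewrite -muE; apply: le_measure; rewrite ?inE.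
  - exact: measurable_punctured_ball.
  - by apply: measurable_box; exact: measurable_itv.
  move=> x /andP[_ x1] i /=; rewrite in_itv/= -ler_norml.
  rewrite -(@expr_le1 _ 2)// real_normK ?num_real//.
  apply: (@le_trans _ _ (enorm x ^+ 2)); last by rewrite expr_le1// enorm_ge0.
  rewrite sqr_enorm /dot (bigD1 i)//= -expr2 lerDl.
  by apply: sumr_ge0 => j _; rewrite -expr2 sqr_ge0.
move: lo hi; case: (lebesgue_rV punctured_ball) => [v| |] //.
by rewrite lee_fin => lo _; exists v => //; apply: lt_le_trans lo; rewrite exprn_gt0.
Qed.

Lemma surface_measureE (A : set V) : surface_measure A =
  (n.+1%:R%:E * lebesgue_rV (punctured_ball `&` normalize @^-1` A))%E.
Proof.
congr (_ * lebesgue_rV _)%E; apply/seteqP; split => y /= [y01].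
  by rewrite /normalize; case: eqP => // y0; move: y01; rewrite y0 ltxx.
rewrite /normalize; case: eqP => // y0; move: y01.
by rewrite /punctured_ball/= y0 ltxx.
Qed.

Lemma surface_measure_sphere :
  surface_measure (@unit_sphere R n.+1) = (n.+1%:R%:E * lebesgue_rV punctured_ball)%E.
Proof.
rewrite surface_measureE; congr (_ * lebesgue_rV _)%E.
apply/seteqP; split => y /=; first by case.
by move=> y01; split => //; exact: unit_sphere_normalize0.
Qed.

Lemma surface_measure_plane_rot (j : 'I_n.+1) c s (A : set V) : j != 0 ->
  c ^+ 2 + s ^+ 2 = 1 -> measurable A ->
  surface_measure (plane_rot 0 j c s @^-1` A) = surface_measure A.
Proof.
move=> j0 cs mA; rewrite !surface_measureE; congr (_ * _)%E.
rewrite -[RHS](@lebesgue_rV_plane_rot _ _ j c s)//; last first.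
  apply: measurableI; first exact: measurable_punctured_ball.
  by rewrite -[X in measurable X]setTI; exact: measurable_normalize.
have enr y : enorm (plane_rot 0 j c s y) = enorm y.
  by rewrite /enorm dot_plane_rot// eq_sym.
congr lebesgue_rV; apply/seteqP; split => y /= [];
  rewrite /punctured_ball/= /normalize enr => y01; (case: eqP => y0;
    [by move: y01; rewrite y0 ltxx|]); by rewrite plane_rotZ; split.
Qed.

Lemma uniform_on_sphere_exists : exists (d : measure_display) (T : measurableType d)
    (P : probability T R) (Y : {RV P >-> V}),
  (forall w, unit_sphere (Y w)) /\ uniform_on_sphere Y.
Proof.
have [mu muE] := @lebesgue_rV_sigma_finite R n.+1.
have [v v0 vE] := punctured_ball_fin.
(* The Dirac mass is only the fallback of [mnormalize] for total mass 0 or infinity, both excluded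
   by [vE]. *)
pose Q : probability V R :=
  mnormalize (mrestr mu measurable_punctured_ball) (\d_(0 : V)).
pose Y : {mfun V >-> V} := HB.pack normalize (isMeasurableFun.Build _ _ _ _ _ measurable_normalize).
exists _, V, Q, Y; split; first exact: unit_sphere_normalize0.
move=> A mA; rewrite surface_measure_sphere surface_measureE vE.
have mT : mrestr mu measurable_punctured_ball setT = v%:E.
  by rewrite /mrestr setTI muE.
rewrite /distribution /pushforward.
rewrite -[Q _]/(mnormalize (mrestr mu measurable_punctured_ball) (\d_(0 : V)) (normalize @^-1` A)).
have mYA : measurable (normalize @^-1` A).
  by rewrite -[X in measurable X]setTI; exact: measurable_normalize.
have [a aE] : exists a, lebesgue_rV (punctured_ball `&` normalize @^-1` A) = a%:E.
  have : (lebesgue_rV (punctured_ball `&` normalize @^-1` A) <= v%:E)%E.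
    rewrite -vE -muE; apply: le_measure; rewrite ?inE.
    - by apply: measurableI => //; exact: measurable_punctured_ball.
    - exact: measurable_punctured_ball.
    - exact: subIsetl.
  have : (0 <= lebesgue_rV (punctured_ball `&` normalize @^-1` A))%E by rewrite -muE.
  by case: (lebesgue_rV _) => // a _ _; exists a.
rewrite (@mnormalizeE _ _ _ (mrestr mu measurable_punctured_ball) _ v _ mT) ?gt_eqF//.
transitivity (a%:E * (v^-1)%:E)%E.
  by congr (_ * _)%E; rewrite -aE setIC -muE.
rewrite aE -!EFinM inver mulf_eq0 pnatr_eq0 (gt_eqF v0) /=.
by congr EFin; field; rewrite gt_eqF//= addrC -natr1 natr1 pnatr_eq0.
Qed.

End uniform_variable.

(** * Means of bounded functions on the sphere *)

Section mean.
Context (R : realType) (n : nat).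
Notation V := 'rV[R]_n.
Implicit Types (f g : V -> R).

(** Measurability is global but the bound is asked on the sphere only, since coordinates and
    exponentials are unbounded on the whole space. *)
Definition sphere_bounded f :=
  measurable_fun setT f /\ exists M : R, forall x, unit_sphere x -> `|f x| <= M.

Lemma sphere_bounded_cst c : sphere_bounded (fun=> c).
Proof. by split => //; exists `|c|. Qed.

Lemma sphere_boundedD f g : sphere_bounded f -> sphere_bounded g ->
  sphere_bounded (fun x => f x + g x).
Proof.
move=> [mf [M fM]] [mg [N gN]]; split; first exact: measurable_funD.
by exists (M + N) => x x1; rewrite (le_trans (ler_normD _ _))// lerD ?fM ?gN.
Qed.

Lemma sphere_boundedM f g : sphere_bounded f -> sphere_bounded g ->
  sphere_bounded (fun x => f x * g x).
Proof.
move=> [mf [M fM]] [mg [N gN]]; split; first exact: measurable_funM.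
by exists (M * N) => x x1; rewrite normrM ler_pM ?fM ?gN.
Qed.

Lemma sphere_boundedZ c f : sphere_bounded f -> sphere_bounded (fun x => c * f x).
Proof. by apply: sphere_boundedM; exact: sphere_bounded_cst. Qed.

Lemma sphere_bounded_coord i : sphere_bounded (fun x => x 0 i).
Proof. by split; [exact: measurable_coord|exists 1 => x x1; exact: norm_coord_le1]. Qed.

Lemma sphere_bounded_sum (I : Type) (r : seq I) (F : I -> V -> R) :
  (forall i, sphere_bounded (F i)) -> sphere_bounded (fun x => \sum_(i <- r) F i x).
Proof.
move=> bF; elim: r => [|i r IH].
  by under eq_fun do rewrite big_nil; exact: sphere_bounded_cst.
by under eq_fun do rewrite big_cons; exact: sphere_boundedD.
Qed.

Lemma sphere_bounded_prod (I : Type) (r : seq I) (F : I -> V -> R) :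
  (forall i, sphere_bounded (F i)) -> sphere_bounded (fun x => \prod_(i <- r) F i x).
Proof.
move=> bF; elim: r => [|i r IH].
  by under eq_fun do rewrite big_nil; exact: sphere_bounded_cst.
by under eq_fun do rewrite big_cons; exact: sphere_boundedM.
Qed.

Lemma sphere_boundedX f k : sphere_bounded f -> sphere_bounded (fun x => f x ^+ k).
Proof.
move=> bf; rewrite (_ : (fun _ => _) = fun x => \prod_(i < k) f x).
  exact: sphere_bounded_prod.
by apply/funext => x; rewrite prodr_const card_ord.
Qed.

Lemma sphere_bounded_expR f : sphere_bounded f -> sphere_bounded (fun x => expR (f x)).
Proof.
move=> [mf [M fM]]; split; first exact: measurableT_comp.
exists (expR M) => x x1; rewrite ger0_norm ?expR_ge0// ler_expR.
exact: le_trans (ler_norm _) (fM x x1).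
Qed.

Lemma sphere_bounded_dot x : sphere_bounded (dot x).
Proof.
apply: sphere_bounded_sum => i; apply: sphere_boundedM; first exact: sphere_bounded_cst.
exact: sphere_bounded_coord.
Qed.

(* Integration of bounded functions against a probability on the sphere. *)
Record sphere_mean (E : (V -> R) -> R) : Prop := SphereMean {
  mean_cst1 : E (fun=> 1) = 1;
  meanD : forall f g, sphere_bounded f -> sphere_bounded g ->
    E (fun x => f x + g x) = E f + E g;
  meanZ : forall c f, sphere_bounded f -> E (fun x => c * f x) = c * E f;
  mean_le : forall f g, sphere_bounded f -> sphere_bounded g ->
    (forall x, unit_sphere x -> f x <= g x) -> E f <= E g;
  mean_cvg : forall (f_ : (V -> R)^nat) f (M : R), (forall k, sphere_bounded (f_ k)) ->
    sphere_bounded f -> (forall k x, unit_sphere x -> `|f_ k x| <= M) ->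
    (forall x, unit_sphere x -> f_ ^~ x @ \oo --> f x) ->
    E \o f_ @ \oo --> E f }.

(** The kernel with one argument fixed thereby becomes a transform, and facts about transforms apply
    to it. *)
Lemma sphere_mean_dirac t : unit_sphere t -> sphere_mean (fun f => f t).
Proof. by move=> t1; split => // [f g _ _ ->//|f_ f M _ _ _]; apply. Qed.

Lemma sphere_mean_plane_rot (i j : 'I_n) c s : i != j -> c ^+ 2 + s ^+ 2 = 1 ->
  forall E, sphere_mean E -> sphere_mean (fun f => E (f \o plane_rot i j c s)).
Proof.
move=> ij cs E mE.
have b f : sphere_bounded f -> sphere_bounded (f \o plane_rot i j c s).
  move=> [mf [M fM]]; split; first exact: measurableT_comp mf (@measurable_plane_rot _ _ i j c s).
  by exists M => x x1; apply: fM; exact: unit_sphere_plane_rot.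
split.
- exact: mean_cst1.
- by move=> f g /b bf /b bg; exact: meanD.
- by move=> a f /b bf; exact: meanZ.
- move=> f g /b bf /b bg fg; apply: mean_le => // x x1.
  by apply: fg; exact: unit_sphere_plane_rot.
- move=> f_ f M bf_ /b bf fM fcvg.
  apply: (mean_cvg mE (M := M) (f_ := fun k => f_ k \o plane_rot i j c s)) => // [k|k x x1|x x1].
  + exact: b.
  + by apply: fM; exact: unit_sphere_plane_rot.
  + by apply: fcvg; exact: unit_sphere_plane_rot.
Qed.

Section mean_theory.
Variables (E : (V -> R) -> R) (mE : sphere_mean E).

Lemma mean_cst c : E (fun=> c) = c.
Proof.
have := meanZ mE c (sphere_bounded_cst 1); rewrite mean_cst1// mulr1 => {2}<-.
by congr E; apply/funext => x; rewrite mulr1.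
Qed.

Lemma mean_eq f g : sphere_bounded f -> sphere_bounded g ->
  (forall x, unit_sphere x -> f x = g x) -> E f = E g.
Proof. by move=> bf bg fg; apply/eqP; rewrite eq_le !mean_le// => x /fg ->. Qed.

Lemma mean_sum (I : Type) (r : seq I) (F : I -> V -> R) :
  (forall i, sphere_bounded (F i)) ->
  E (fun x => \sum_(i <- r) F i x) = \sum_(i <- r) E (F i).
Proof.
move=> bF; elim: r => [|i r IH].
  by under eq_fun do rewrite big_nil; rewrite mean_cst big_nil.
under eq_fun do rewrite big_cons; rewrite big_cons -IH meanD//.
exact: sphere_bounded_sum.
Qed.

Lemma meanB f g : sphere_bounded f -> sphere_bounded g ->
  E (fun x => f x - g x) = E f - E g.
Proof.
move=> bf bg; under eq_fun do rewrite -mulN1r.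
by rewrite meanD ?meanZ ?mulN1r//; exact: sphere_boundedZ.
Qed.

End mean_theory.
End mean.

Lemma integrable_sphere_bounded (R : realType) (n : nat) d (T : measurableType d)
    (P : probability T R) (X : {mfun T >-> 'rV[R]_n}) (f : 'rV[R]_n -> R) :
  (forall w, unit_sphere (X w)) -> sphere_bounded f ->
  P.-integrable setT (EFin \o (f \o X)).
Proof.
move=> X1 [mf [M fM]]; have PT : (P setT < +oo)%E by rewrite probability_setT ltry.
apply: measurable_bounded_integrable => //; first exact: measurableT_comp.
by exists M; split; [exact: num_real|move=> y My w _; apply: le_trans (ltW My); exact: fM].
Qed.

Lemma sphere_mean_RV (R : realType) (n : nat) d (T : measurableType d)
    (P : probability T R) (X : {mfun T >-> 'rV[R]_n}) :
  (forall w, unit_sphere (X w)) ->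
  sphere_mean (fun f => \int[P]_w f (X w)).
Proof.
move=> X1.
have b f : sphere_bounded f -> P.-integrable setT (EFin \o (f \o X)).
  exact: integrable_sphere_bounded.
split.
- rewrite Rintegral_cst// mul1r -[RHS]/(fine 1%E); congr fine.
  exact: probability_setT.
- by move=> f g /b bf /b bg; rewrite RintegralD.
- by move=> c f /b bf; rewrite RintegralZl.
- by move=> f g /b bf /b bg fg; apply: le_Rintegral => // w _; exact: fg.
- move=> f_ f M bf_ bf fM fcvg.
  have [| | | | | _ _ H] := @dominated_convergence _ _ _ P _ measurableT
     (fun k w => (f_ k (X w))%:E) (fun w => (f (X w))%:E) (fun=> M%:E).
  + by move=> k; apply/measurable_EFinP; apply: measurableT_comp => //; exact: (bf_ k).1.
  + by apply/measurable_EFinP; apply: measurableT_comp => //; exact: bf.1.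
  + by apply: aeW => w _; apply: cvg_EFin; [exact: nearW|exact: fcvg].
  + exact: finite_measure_integrable_cst.
  + by apply: aeW => w k _ /=; rewrite lee_fin fM.
  + have := fine_cvg; apply => /=.
    by rewrite fineK; [exact: H|apply: integrable_fin_num => //; exact: b].
Qed.

(** * The exponential kernel *)

Section kernel.
Context (R : realType) (n : nat) (lambda : R).
Hypothesis lambda_gt0 : 0 < lambda.
Notation V := 'rV[R]_n.

(** Indexing by functions rather than by multi-indices avoids multinomial coefficients in [dotX]. *)
Definition monomial k (f : {ffun 'I_k -> 'I_n}) (x : V) : R := \prod_(j < k) x 0 (f j).

Lemma sphere_bounded_monomial k (f : {ffun 'I_k -> 'I_n}) : sphere_bounded (monomial f).
Proof. by apply: sphere_bounded_prod => j; exact: sphere_bounded_coord. Qed.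

Lemma dotX (x y : V) k :
  dot x y ^+ k = \sum_(f : {ffun 'I_k -> 'I_n}) monomial f x * monomial f y.
Proof.
rewrite -[LHS](_ : \prod_(j < k) \sum_i x 0 i * y 0 i = _); last first.
  by rewrite prodr_const card_ord.
by rewrite bigA_distr_bigA; apply: eq_bigr => f _; rewrite /monomial big_split.
Qed.

Definition transform (E : (V -> R) -> R) (x : V) : R := E (fun y => expR (lambda * dot x y)).

Definition transform_part (E : (V -> R) -> R) N (x : V) : R :=
  \sum_(k < N) lambda ^+ k / k`!%:R *
    \sum_(f : {ffun 'I_k -> 'I_n}) monomial f x * E (monomial f).

(** Partial sum, over degrees below [N], of the inner product of the two laws in the Hilbert space
    of the kernel. *)
Definition energy_part (E F : (V -> R) -> R) N : R :=
  \sum_(k < N) lambda ^+ k / k`!%:R *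
    \sum_(f : {ffun 'I_k -> 'I_n}) E (monomial f) * F (monomial f).

Lemma norm_series_exp_coeff (u : R) N : `|series (exp_coeff u) N| <= expR `|u|.
Proof.
apply: (@le_trans _ _ (series (exp_coeff `|u|) N)).
  rewrite /series/=; apply: le_trans (ler_norm_sum _ _ _) _.
  by apply: ler_sum => k _; rewrite /exp_coeff/= normrM normrX [X in _ * X]ger0_norm// invr_ge0.
apply: nondecreasing_cvgn_le; last exact: is_cvg_series_exp_coeff.
by apply: nondecreasing_series => k _ _; exact: exp_coeff_ge0.
Qed.

Lemma sphere_bounded_series_exp_coeff x N :
  sphere_bounded (fun y : V => series (exp_coeff (lambda * dot x y)) N).
Proof.
rewrite /series/=; apply: sphere_bounded_sum => k; rewrite /exp_coeff/=.
under eq_fun do rewrite mulrC.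
by apply: sphere_boundedZ; apply: sphere_boundedX; apply: sphere_boundedZ; exact: sphere_bounded_dot.
Qed.

Lemma sphere_bounded_kernel x : sphere_bounded (fun y : V => expR (lambda * dot x y)).
Proof. by apply: sphere_bounded_expR; apply: sphere_boundedZ; exact: sphere_bounded_dot. Qed.

Section one_mean.
Variables (E : (V -> R) -> R) (mE : sphere_mean E).

Lemma transform_partE N x :
  transform_part E N x = E (fun y => series (exp_coeff (lambda * dot x y)) N).
Proof.
transitivity (E (fun y => \sum_(k < N) lambda ^+ k / k`!%:R *
    \sum_(f : {ffun 'I_k -> 'I_n}) monomial f x * monomial f y)).
  have bf k (f : {ffun 'I_k -> 'I_n}) : sphere_bounded (fun y => monomial f x * monomial f y).
    exact/sphere_boundedZ/sphere_bounded_monomial.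
  have bs k : sphere_bounded (fun y => \sum_(f : {ffun 'I_k -> 'I_n}) monomial f x * monomial f y).
    by apply: sphere_bounded_sum => f; exact: bf.
  rewrite mean_sum//; last by move=> k; exact/sphere_boundedZ.
  apply: eq_bigr => k _; rewrite meanZ// mean_sum//; congr (_ * _).
  by apply: eq_bigr => f _; rewrite meanZ//; exact: sphere_bounded_monomial.
congr E; apply/funext => y; rewrite /series/= big_mkord; apply: eq_bigr => k _.
by rewrite /exp_coeff/= exprMn -dotX mulrAC.
Qed.

Lemma cvg_transform_part x : transform_part E ^~ x @ \oo --> transform E x.
Proof.
rewrite (_ : transform_part E ^~ x =
  E \o (fun N y => series (exp_coeff (lambda * dot x y)) N)); last first.
  by apply/funext => N; rewrite /= transform_partE.
have [_ [M xM]] := sphere_boundedZ lambda (sphere_bounded_dot x).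
apply: (mean_cvg mE (M := expR M)) => [k||k y y1|y _].
- exact: sphere_bounded_series_exp_coeff.
- exact: sphere_bounded_kernel.
- by rewrite (le_trans (norm_series_exp_coeff _ _))// ler_expR xM.
- exact: is_cvg_series_exp_coeff.
Qed.

Lemma norm_transform_part N x : unit_sphere x -> `|transform_part E N x| <= expR lambda.
Proof.
move=> x1; rewrite transform_partE.
have h y : unit_sphere y -> `|series (exp_coeff (lambda * dot x y)) N| <= expR lambda.
  move=> y1; rewrite (le_trans (norm_series_exp_coeff _ _))// ler_expR normrM gtr0_norm//.
  by rewrite -[leRHS]mulr1 ler_pM2l// norm_dot_le1.
rewrite ler_norml -[leLHS](mean_cst mE) -[X in _ && (_ <= X)](mean_cst mE).
apply/andP; split; apply: (mean_le mE); try exact: sphere_bounded_cst;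
  try exact: sphere_bounded_series_exp_coeff.
- by move=> y /h; rewrite ler_norml => /andP[].
- by move=> y /h; rewrite ler_norml => /andP[].
Qed.

Lemma sphere_bounded_transform_part N : sphere_bounded (transform_part E N).
Proof.
apply: sphere_bounded_sum => k; apply: sphere_boundedZ; apply: sphere_bounded_sum => f.
by apply: sphere_boundedM; [exact: sphere_bounded_monomial|exact: sphere_bounded_cst].
Qed.

Lemma sphere_bounded_transform : sphere_bounded (transform E).
Proof.
split.
  apply: (@measurable_fun_cvg _ _ _ _ (fun N x => transform_part E N x)).
  - by move=> N; exact: (sphere_bounded_transform_part N).1.
  - by move=> x _; exact: cvg_transform_part.
exists (expR lambda) => x x1.
have h : (fun N => `|transform_part E N x|) @ \oo --> `|transform E x|.
  by apply: cvg_norm; exact: cvg_transform_part.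
rewrite -(cvg_lim _ h)//; apply: limr_le; first by apply/cvg_ex; eexists; exact: h.
by apply: nearW => N; exact: norm_transform_part.
Qed.

End one_mean.

Lemma cvg_energy_part E F : sphere_mean E -> sphere_mean F ->
  energy_part E F @ \oo --> E (transform F).
Proof.
move=> mE mF; rewrite (_ : energy_part E F = E \o transform_part F); last first.
  apply/funext => N /=; rewrite /transform_part.
  have bf k (f : {ffun 'I_k -> 'I_n}) :
      sphere_bounded (fun x => monomial f x * F (monomial f)).
    by apply: sphere_boundedM; [exact: sphere_bounded_monomial|exact: sphere_bounded_cst].
  have bs k : sphere_bounded (fun x => \sum_(f : {ffun 'I_k -> 'I_n}) monomial f x * F (monomial f)).
    by apply: sphere_bounded_sum => f; exact: bf.
  rewrite mean_sum//; last by move=> k; exact/sphere_boundedZ.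
  apply: eq_bigr => k _; rewrite meanZ// mean_sum//; congr (_ * _).
  apply: eq_bigr => f _; under eq_fun do rewrite mulrC.
  rewrite (meanZ mE); first exact: mulrC.
  exact: sphere_bounded_monomial.
apply: (mean_cvg mE (M := expR lambda)) => [k||k x x1|x _].
- exact: sphere_bounded_transform_part.
- exact: sphere_bounded_transform.
- exact: norm_transform_part.
- exact: cvg_transform_part.
Qed.

Lemma energy_partC E F N : energy_part E F N = energy_part F E N.
Proof.
by apply: eq_bigr => k _; congr (_ * _); apply: eq_bigr => f _; rewrite mulrC.
Qed.

(** An exchange of integrals without a product measure: both sides are limits of the same symmetric
    partial sums. *)
Lemma transformC E F : sphere_mean E -> sphere_mean F -> E (transform F) = F (transform E).
Proof.
move=> mE mF; have h := cvg_energy_part mF mE.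
rewrite (_ : energy_part F E = energy_part E F) in h; last first.
  by apply/funext => N; exact: energy_partC.
by rewrite -(cvg_lim _ h)// -(cvg_lim _ (cvg_energy_part mE mF)).
Qed.

(* Squared norm of [s E1 + E2 - E3] in the reproducing kernel Hilbert space of
   [expR (lambda * dot x y)]. *)
Lemma energy_ge0 E1 E2 E3 s : sphere_mean E1 -> sphere_mean E2 -> sphere_mean E3 ->
  0 <= s ^+ 2 * E1 (transform E1) + E2 (transform E2) + E3 (transform E3)
    + 2 * s * (E1 (transform E2) - E1 (transform E3)) - 2 * E2 (transform E3).
Proof.
move=> m1 m2 m3.
pose u N := s ^+ 2 * energy_part E1 E1 N + energy_part E2 E2 N + energy_part E3 E3 N
    + 2 * s * (energy_part E1 E2 N - energy_part E1 E3 N) - 2 * energy_part E2 E3 N.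
have ucvg : u @ \oo --> s ^+ 2 * E1 (transform E1) + E2 (transform E2) + E3 (transform E3)
    + 2 * s * (E1 (transform E2) - E1 (transform E3)) - 2 * E2 (transform E3).
  apply: cvgB; last by apply: cvgMr; exact: cvg_energy_part.
  apply: cvgD; last by apply: cvgMr; apply: cvgB; exact: cvg_energy_part.
  apply: cvgD; last exact: cvg_energy_part.
  apply: cvgD; last exact: cvg_energy_part.
  by apply: cvgMr; exact: cvg_energy_part.
rewrite -(cvg_lim _ ucvg)//; apply: limr_ge; first by apply/cvg_ex; eexists; exact: ucvg.
apply: nearW => N.
(* In each degree the quadratic form is a sum of squares with a positive weight; the limit keeps the
   sign. *)
rewrite [u N](_ : _ = \sum_(k < N) lambda ^+ k / k`!%:R * \sum_(f : {ffun 'I_k -> 'I_n})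
    (s * E1 (monomial f) + E2 (monomial f) - E3 (monomial f)) ^+ 2).
  apply: sumr_ge0 => k _; rewrite mulr_ge0 ?divr_ge0 ?exprn_ge0 ?(ltW lambda_gt0)//.
  by apply: sumr_ge0 => f _; exact: sqr_ge0.
rewrite /u /energy_part -sumrB !mulr_sumr -sumrN -!big_split/=; apply: eq_bigr => k _.
pose S (G H : (V -> R) -> R) := \sum_(f : {ffun 'I_k -> 'I_n}) G (monomial f) * H (monomial f).
rewrite (_ : \sum_(f : {ffun 'I_k -> 'I_n}) (s * E1 (monomial f) + E2 (monomial f)
    - E3 (monomial f)) ^+ 2 = s ^+ 2 * S E1 E1 + S E2 E2 + S E3 E3
    + 2 * s * (S E1 E2 - S E1 E3) - 2 * S E2 E3); first by rewrite /S; ring.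
rewrite /S -sumrB !mulr_sumr -sumrN -!big_split/=; apply: eq_bigr => f _.
by ring.
Qed.

Lemma eq_mean_monomial E F c c' : sphere_mean E -> sphere_mean F ->
  (forall x, unit_sphere x -> transform E x = c) ->
  (forall x, unit_sphere x -> transform F x = c') ->
  forall k (f : {ffun 'I_k -> 'I_n}), E (monomial f) = F (monomial f).
Proof.
move=> mE mF Ec Fc.
have meanc G H a : sphere_mean G -> sphere_mean H ->
    (forall x, unit_sphere x -> transform G x = a) -> H (transform G) = a.
  move=> mG mH Ga; rewrite -[RHS](mean_cst mH a); apply: mean_eq => //.
    exact: sphere_bounded_transform.
  exact: sphere_bounded_cst.
(* The two constants are not assumed equal: both are the mutual energy of the two laws. *)
have cc' : c = c' by rewrite -(meanc E F c)// transformC// (meanc F E c').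
pose u N := \sum_(k < N) lambda ^+ k / k`!%:R * \sum_(f : {ffun 'I_k -> 'I_n})
    (E (monomial f) - F (monomial f)) ^+ 2.
have uE N : u N = energy_part E E N - 2 * energy_part E F N + energy_part F F N.
  rewrite /u /energy_part mulr_sumr -sumrN -!big_split/=; apply: eq_bigr => k _.
  pose S (G H : (V -> R) -> R) := \sum_(f : {ffun 'I_k -> 'I_n}) G (monomial f) * H (monomial f).
  rewrite (_ : \sum_(f : {ffun 'I_k -> 'I_n}) (E (monomial f) - F (monomial f)) ^+ 2 =
    S E E - 2 * S E F + S F F); first by rewrite /S; ring.
  rewrite /S mulr_sumr -sumrN -!big_split/=; apply: eq_bigr => f _; by ring.
have u0 : u @ \oo --> (0 : R).
  rewrite [X in _ --> X](_ : 0 = c - 2 * c + c); last by ring.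
  rewrite (_ : u = fun N => energy_part E E N - 2 * energy_part E F N + energy_part F F N);
    last exact/funext.
  apply: cvgD; [apply: cvgB|].
  - by rewrite -[X in _ --> X](meanc E E c)//; exact: cvg_energy_part.
  - by apply: cvgMr; rewrite -[X in _ --> X](meanc F E c) ?cc'//; exact: cvg_energy_part.
  - by rewrite -[X in _ --> X](meanc F F c) ?cc'//; exact: cvg_energy_part.
have t0 k : 0 <= lambda ^+ k / k`!%:R * \sum_(f : {ffun 'I_k -> 'I_n})
    (E (monomial f) - F (monomial f)) ^+ 2.
  rewrite mulr_ge0 ?divr_ge0 ?exprn_ge0 ?(ltW lambda_gt0)//.
  by apply: sumr_ge0 => f _; exact: sqr_ge0.
(* A nondecreasing sequence with limit 0 is at most 0, so each of its nonnegative increments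
   vanishes, and with it every square in that degree. *)
have und : nondecreasing_seq u.
  by apply/nondecreasing_seqP => N; rewrite /u big_ord_recr/= lerDl.
move=> k f.
have : u k.+1 <= 0.
  by rewrite -(cvg_lim _ u0)//; apply: nondecreasing_cvgn_le => //; apply/cvg_ex; exists 0.
rewrite /u big_ord_recr/= => uk.
have {uk} : lambda ^+ k / k`!%:R * \sum_(g : {ffun 'I_k -> 'I_n})
    (E (monomial g) - F (monomial g)) ^+ 2 <= 0.
  apply: le_trans uk; rewrite lerDr; apply: sumr_ge0 => i _; exact: t0.
rewrite pmulr_rle0; last by rewrite divr_gt0 ?exprn_gt0// ltr0n fact_gt0.
move=> s0; apply/eqP; rewrite -subr_eq0 -sqrf_eq0 eq_le sqr_ge0 andbT.
apply: le_trans s0; rewrite (bigD1 f)//= lerDl.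
by apply: sumr_ge0 => g _; exact: sqr_ge0.
Qed.

End kernel.

(** * Moments determine the distribution *)

Section determined_by_moments.
Context (R : realType) (n : nat).
Notation V := 'rV[R]_n.
Variables E F : (V -> R) -> R.
Hypotheses (mE : sphere_mean E) (mF : sphere_mean F).
Hypothesis EF : forall k (f : {ffun 'I_k -> 'I_n}), E (monomial f) = F (monomial f).

Definition word (s : seq 'I_n) (x : V) : R := \prod_(i <- s) x 0 i.

Lemma sphere_bounded_word s : sphere_bounded (word s).
Proof. by apply: sphere_bounded_prod => i; exact: sphere_bounded_coord. Qed.

Lemma eq_mean_word s : E (word s) = F (word s).
Proof.
rewrite (_ : word s = monomial [ffun j => tnth (in_tuple s) j])//.
apply/funext => x; rewrite /word /monomial big_tnth.
by apply: eq_bigr => j _; rewrite ffunE.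
Qed.

(** Testing against all words, and not against 1 alone, makes the property stable under
    multiplication by a coordinate, hence by polynomials and by their bounded limits. *)
Definition agree (f : V -> R) := sphere_bounded f /\
  forall s, E (fun x => f x * word s x) = F (fun x => f x * word s x).

Lemma agree1 : agree (fun=> 1).
Proof.
split=> [|s]; first exact: sphere_bounded_cst.
by under eq_fun do rewrite mul1r; exact: eq_mean_word.
Qed.

Lemma agreeD f g : agree f -> agree g -> agree (fun x => f x + g x).
Proof.
move=> [bf Ef] [bg Eg]; split=> [|s]; first exact: sphere_boundedD.
have bw h : sphere_bounded h -> sphere_bounded (fun x => h x * word s x).
  by move=> bh; apply: sphere_boundedM => //; exact: sphere_bounded_word.
by under eq_fun do rewrite mulrDl; rewrite !meanD ?Ef ?Eg//; exact: bw.
Qed.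

Lemma agreeZ c f : agree f -> agree (fun x => c * f x).
Proof.
move=> [bf Ef]; split=> [|s]; first exact: sphere_boundedZ.
under eq_fun do rewrite -mulrA; rewrite !meanZ ?Ef//.
all: by apply: sphere_boundedM => //; exact: sphere_bounded_word.
Qed.

Lemma agreeB f g : agree f -> agree g -> agree (fun x => f x - g x).
Proof.
move=> af ag; under eq_fun do rewrite -mulN1r.
by apply: agreeD => //; exact: agreeZ.
Qed.

Lemma agree_coord i f : agree f -> agree (fun x => f x * x 0 i).
Proof.
move=> [bf Ef]; split=> [|s].
  by apply: sphere_boundedM => //; exact: sphere_bounded_coord.
have -> : (fun x => f x * x 0 i * word s x) = (fun x => f x * word (i :: s) x).
  by apply/funext => x; rewrite /word big_cons mulrA.
exact: Ef.
Qed.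

Lemma agree_poly i (q : {poly R}) f : agree f -> agree (fun x => f x * q.[x 0 i]).
Proof.
move=> af; elim/poly_ind: q => [|q c IH].
  rewrite (_ : (fun _ => _) = fun x => 0 * f x); first exact: agreeZ.
  by apply/funext => x; rewrite horner0 mulr0 mul0r.
under eq_fun do rewrite hornerMXaddC mulrDr mulrA (mulrC _ c).
by apply: agreeD; [exact: agree_coord|exact: agreeZ].
Qed.

Lemma agree_cvg (f_ : (V -> R)^nat) (f : V -> R) (M : R) : (forall k, agree (f_ k)) ->
  measurable_fun setT f -> (forall k x, unit_sphere x -> `|f_ k x| <= M) ->
  (forall x, unit_sphere x -> f_ ^~ x @ \oo --> f x) -> agree f.
Proof.
move=> af_ mf fM fcvg.
have bf : sphere_bounded f.
  split => //; exists M => x x1.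
  have h : (fun k => `|f_ k x|) @ \oo --> `|f x| by apply: cvg_norm; exact: fcvg.
  rewrite -(cvg_lim _ h)//; apply: limr_le; first by apply/cvg_ex; eexists; exact: h.
  by apply: nearW => k; exact: fM.
split => // s; have [_ [N sN]] := sphere_bounded_word s.
have bw h : sphere_bounded h -> sphere_bounded (fun x => h x * word s x).
  by move=> bh; apply: sphere_boundedM => //; exact: sphere_bounded_word.
have H G : sphere_mean G ->
    G \o (fun k x => f_ k x * word s x) @ \oo --> G (fun x => f x * word s x).
  move=> mG; apply: (mean_cvg mG (M := M * N)) => [k||k x x1|x x1].
  - by apply: bw; case: (af_ k).
  - exact: bw.
  - by rewrite normrM ler_pM ?fM ?sN.
  - by apply: cvgMl; exact: fcvg.
have h := H F mF; rewrite (_ : F \o _ = E \o (fun k x => f_ k x * word s x)) in h; last first.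
  by apply/funext => k /=; case: (af_ k) => _ ->.
by rewrite -(cvg_lim _ h)// -(cvg_lim _ (H E mE)).
Qed.

Lemma bernoulli_ineq (u : R) m : -1 <= u -> 1 + m%:R * u <= (1 + u) ^+ m.
Proof.
move=> u1; elim: m => [|m IH]; first by rewrite mul0r addr0 expr0.
rewrite exprS; apply: (@le_trans _ _ ((1 + u) * (1 + m%:R * u))).
  rewrite -subr_ge0 -natr1.
  have -> : (1 + u) * (1 + m%:R * u) - (1 + (m%:R + 1) * u) = m%:R * u ^+ 2 by ring.
  by rewrite mulr_ge0// sqr_ge0.
by apply: ler_wpM2l => //; lra.
Qed.

(** These polynomials approximate a step at 1/2, as in the elementary proof of the Stone-Weierstrass
    theorem by Brosowski and Deutsch. Bernoulli's inequality bounds them below by [1 - (2 y)^k]. *)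
Lemma cvg_step1 (y : R) : 0 <= y -> y < 1 / 2 ->
  (fun k => (1 - y ^+ k) ^+ (2 ^ k)) @ \oo --> (1 : R).
Proof.
move=> y0 y12; apply: (@squeeze_cvgr _ _ _ _ (fun k => 1 - (2 * y) ^+ k) (fun=> 1)).
- apply: nearW => k; have yk1 : y ^+ k <= 1 by apply: exprn_ile1 => //; lra.
  have yk0 : 0 <= y ^+ k by exact: exprn_ge0.
  apply/andP; split; last by apply: exprn_ile1; lra.
  apply: le_trans (bernoulli_ineq (u := - y ^+ k) (2 ^ k) _); last by lra.
  by rewrite mulrN exprMn natrX.
- rewrite -[X in _ --> X]subr0; apply: cvgB; first exact: cvg_cst.
  by apply: cvg_expr; rewrite ger0_norm; lra.
- exact: cvg_cst.
Qed.

(** Multiplied by [(1 + y^k)^(2^k)], which is at least [(2 y)^k] by Bernoulli's inequality, the term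
    stays at most 1. *)
Lemma cvg_step0 (y : R) : 1 / 2 < y -> y <= 1 ->
  (fun k => (1 - y ^+ k) ^+ (2 ^ k)) @ \oo --> (0 : R).
Proof.
move=> y12 y1; apply: (@squeeze_cvgr _ _ _ _ (fun=> 0) (fun k => ((2 * y)^-1) ^+ k)).
- apply: nearW => k; have yk1 : y ^+ k <= 1 by apply: exprn_ile1 => //; lra.
  have yk0 : 0 < y ^+ k by apply: exprn_gt0; lra.
  have yk : 0 < (2 * y) ^+ k by apply: exprn_gt0; lra.
  rewrite exprn_ge0 ?subr_ge0//= exprVn -[leRHS]mul1r ler_pdivlMr//.
  apply: (@le_trans _ _ ((1 - y ^+ k) ^+ (2 ^ k) * (1 + y ^+ k) ^+ (2 ^ k))).
    apply: ler_wpM2l; first by rewrite exprn_ge0 ?subr_ge0.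
    apply: le_trans (bernoulli_ineq (2 ^ k) _); last by lra.
    by rewrite exprMn natrX lerDr.
  rewrite -exprMn; apply: exprn_ile1; first by apply: mulr_ge0; lra.
  have -> : (1 - y ^+ k) * (1 + y ^+ k) = 1 - (y ^+ k) ^+ 2 by ring.
  by rewrite gerBl sqr_ge0.
- exact: cvg_cst.
- apply: cvg_expr; rewrite ger0_norm ?invr_ge0; last by lra.
  by rewrite invf_lt1; lra.
Qed.

Lemma measurable_indic_coord i (B : set R) : measurable B ->
  measurable_fun setT (fun x : V => \1_B (x 0 i) : R).
Proof.
move=> mB; apply: (@measurableT_comp _ _ _ _ _ _ (\1_B : R -> R)) => //.
exact: measurable_coord.
Qed.

(* With [rho = (x_i - a) / b], [(1 - rho^2)^k] tends to the indicator of [x_i = a];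
   once this value is removed, [(1 - (1/2 - rho)^k)^(2^k)] tends to the indicator of [x_i > a]. *)
Lemma agree_ray i a f : agree f -> agree (fun x => f x * \1_(`]a, +oo[%classic) (x 0 i)).
Proof.
move=> af; have [bf _] := af; have [mf [M fM]] := bf.
(* With this scale [1 / 2 - rho] stays in [[0, 1]] on the sphere, where the step lemmas apply, and
   the jump at 1/2 corresponds to [x 0 i = a]. *)
pose b := 4 * (1 + `|a|).
have b0 : 0 < b by rewrite /b; have := normr_ge0 a; lra.
pose rho (x : V) := (x 0 i - a) / b.
have rho_half x : unit_sphere x -> `|rho x| <= 1 / 2.
  move=> x1; rewrite normrM (gtr0_norm (x := b^-1)) ?invr_gt0// ler_pdivrMr//.
  apply: le_trans (ler_normB _ _) _.
  by have := norm_coord_le1 i x1; have := normr_ge0 a; rewrite /b; lra.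
have rhoE (q : {poly R}) (x : V) : (q \Po ((b^-1)%:P * ('X - a%:P))).[x 0 i] = q.[rho x].
  by rewrite horner_comp !hornerE mulrC.
have ne : agree (fun x => f x * (1 - \1_[set a] (x 0 i))).
  under eq_fun do rewrite mulrBr mulr1.
  apply: agreeB => //.
  apply: (@agree_cvg (fun k x => f x * (1 - rho x ^+ 2) ^+ k) _ M).
  - move=> k; have := agree_poly i (((1 - 'X^2) ^+ k) \Po ((b^-1)%:P * ('X - a%:P))) af.
    by congr agree; apply/funext => x; rewrite rhoE !hornerE.
  - by apply: measurable_funM => //; exact: measurable_indic_coord.
  - move=> k x x1; rewrite normrM -[leRHS]mulr1 ler_pM ?fM// normrX.
    have := rho_half x x1; rewrite ler_norml => h.
    apply: exprn_ile1 => //; rewrite ler_norml; nra.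
  - move=> x x1; apply: cvgMr; rewrite indicE; have := rho_half x x1.
    rewrite ler_norml => h; have [xa|xa] := eqVneq (x 0 i) a.
      rewrite mem_set//=; apply: cvg_near_cst; apply: nearW => k.
      by rewrite /rho xa subrr mul0r expr0n subr0 expr1n.
    rewrite memNset; last exact/eqP.
    have rho0 : 0 < rho x ^+ 2.
      by rewrite exprn_even_gt0//= mulf_neq0 ?subr_eq0// invr_neq0// gt_eqF.
    by apply: cvg_expr; rewrite ltr_norml; nra.
apply: (@agree_cvg (fun k x => f x * (1 - \1_[set a] (x 0 i)) *
   (1 - (1 / 2 - rho x) ^+ k) ^+ (2 ^ k)) _ M).
- move=> k; have := agree_poly i (((1 - ((1 / 2)%:P - 'X) ^+ k) ^+ (2 ^ k)) \Po
    ((b^-1)%:P * ('X - a%:P))) ne.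
  by congr agree; apply/funext => x; rewrite rhoE !hornerE.
- apply: measurable_funM => //; apply: measurable_indic_coord.
  exact: measurable_itv.
- move=> k x x1; rewrite -mulrA normrM -[leRHS]mulr1 ler_pM ?fM//.
  rewrite normrM -[leRHS]mulr1 ler_pM//.
    by rewrite indicE; case: (_ \in _); rewrite ?subrr ?subr0 ?normr0 ?normr1.
  rewrite normrX; apply: exprn_ile1 => //.
  have := rho_half x x1; rewrite ler_norml => /andP[h1 h2].
  have e0 : 0 <= (1 / 2 - rho x) ^+ k by apply: exprn_ge0; lra.
  have e1 : (1 / 2 - rho x) ^+ k <= 1 by apply: exprn_ile1; lra.
  by rewrite ler_norml; lra.
- move=> x x1; have := rho_half x x1; rewrite ler_norml => /andP[h1 h2].
  have [xa|xa|xa] := ltrgtP (x 0 i) a.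
  + have r0 : rho x < 0 by rewrite /rho pmulr_llt0 ?invr_gt0// subr_lt0.
    rewrite [X in _ --> f x * X](_ : _ = 0); last first.
      by rewrite indicE memNset//= in_itv/= andbT ltNge (ltW xa).
    rewrite mulr0 -[X in _ --> X](mulr0 (f x * (1 - \1_[set a] (x 0 i)))).
    by apply: cvgMr; apply: cvg_step0; lra.
  + have r0 : 0 < rho x by rewrite /rho divr_gt0// subr_gt0.
    rewrite [X in _ --> f x * X](_ : _ = 1); last first.
      by rewrite indicE mem_set//= in_itv/= andbT.
    rewrite (_ : 1 - \1_[set a] (x 0 i) = 1); last first.
      by rewrite indicE memNset ?subr0//=; move/eqP; rewrite gt_eqF.
    rewrite !mulr1 -[X in _ --> X]mulr1.
    by apply: cvgMr; apply: cvg_step1; lra.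
  (* At the jump itself the polynomials tend to [1 / e]; the factor that removes the value [a] makes
     every term zero. *)
  + rewrite [X in _ --> f x * X](_ : _ = 0); last first.
      by rewrite indicE memNset//= in_itv/= andbT xa ltxx.
    rewrite (_ : 1 - \1_[set a] (x 0 i) = 0); last first.
      by rewrite indicE mem_set ?subrr.
    rewrite mulr0; under eq_fun do rewrite mul0r; exact: cvg_cst.
Qed.

(* Stability of [agree] under products with [\1_D] makes these sets closed under
   intersections, hence a sigma-algebra and not only a lambda-system. *)
Definition agree_set (D : set V) := measurable D /\
  forall f, agree f -> agree (fun x => f x * \1_D x).

Lemma agree_set_sigma_algebra : sigma_algebra setT agree_set.
Proof.
have agreeC D : agree_set D -> agree_set (~` D).
  move=> [mD aD]; split=> [|f af]; first exact: measurableC.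
  rewrite (_ : (fun _ => _) = (fun x => f x - f x * \1_D x)); first exact: agreeB (aD _ af).
  apply/funext => x; rewrite !indicE in_setC.
  by case: (x \in D); rewrite /= ?mulr0 ?mulr1 ?subrr ?subr0.
split.
- split => // f af; rewrite (_ : (fun _ => _) = fun x => 0 * f x); first exact: agreeZ.
  by apply/funext => x; rewrite indic0 mulr0 mul0r.
- by move=> D aD; rewrite setTD; exact: agreeC.
(* By complementation it is enough to treat a countable intersection, whose indicator is the bounded
   limit of finite products of indicators. *)
- move=> D_ aD_; rewrite -[\bigcup_k _]setCK; apply: (agreeC _); rewrite setC_bigcup.
  have mD : measurable (\bigcap_k ~` D_ k).
    rewrite -setC_bigcup; apply: measurableC; apply: bigcupT_measurable => k.
    exact: (aD_ k).1.
  split => // f af; have [[mf [M fM]] _] := af.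
  pose g N x : R := f x * \prod_(k < N) \1_(~` D_ k) x.
  have p01 N x : 0 <= (\prod_(k < N) \1_(~` D_ k) x : R) <= 1.
    apply/andP; split; first by apply: prodr_ge0 => k _.
    by apply: prodr_ile1 => k _; rewrite indicE; case: (_ \in _); rewrite /= ?lexx ?ler01.
  apply: (@agree_cvg g _ M).
  + elim=> [|N IH]; rewrite /g.
      by under eq_fun do rewrite big_ord0 mulr1.
    under eq_fun do rewrite big_ord_recr/= mulrA.
    by apply: (agreeC _ (aD_ N)).2.
  + by apply: measurable_funM => //; exact: measurable_indic.
  + move=> N x x1; rewrite normrM -[leRHS]mulr1 ler_pM ?fM//.
    by rewrite ger0_norm; case/andP: (p01 N x).
  + move=> x _; apply: cvgMr; rewrite indicE.
    have [xD|xD] := boolP (x \in _).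
      apply: cvg_near_cst; apply: nearW => N; apply: big1 => k _; rewrite indicE mem_set//.
      by move/set_mem: xD; apply.
    have [k xk] : exists k, D_ k x.
      apply: contrapT => h; move/negP: xD; apply; apply/mem_set => k _ Dk.
      by apply: h; exists k.
    apply: cvg_near_cst; exists k.+1 => // N kN /=.
    rewrite (bigD1 (Ordinal kN))//= indicE memNset ?mul0r//; exact.
Qed.

Lemma agree_set_measurable D : measurable D -> agree_set D.
Proof.
move: D; apply: smallest_sub; first exact: agree_set_sigma_algebra.
rewrite -bigcup_seq => _ [i _ [B mB <-]] /=; rewrite setTI.
have [s0 sC sU] := agree_set_sigma_algebra.
(* Second generation step: the Borel sets of each coordinate come from open rays, the case of
   [agree_ray]. *)
have mR : (measurable : set (set R)) = <<s @RGenOInfty.G R >> := RGenOInfty.measurableE R.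
move: B mB; rewrite mR; apply: smallest_sub.
  split.
  - by rewrite /= preimage_set0.
  - by move=> B /= aB; rewrite setTD preimage_setC -setTD; exact: sC.
  - by move=> B aB /=; rewrite preimage_bigcup; exact: sU.
move=> _ [a ->] /=; split; last by move=> f; exact: agree_ray.
rewrite -[X in measurable X]setTI; exact: measurable_coord.
Qed.

Lemma eq_mean_indic D : measurable D -> E (\1_D) = F (\1_D).
Proof.
move=> /agree_set_measurable[_ /(_ _ agree1)[_ /(_ [::])]].
by congr (_ = _); [congr E|congr F]; apply/funext => x; rewrite /word big_nil mulr1 mul1r.
Qed.

End determined_by_moments.

(** * Transforms annihilated by the spherical Laplacian *)

(** The bound holds for either sign of [u] because the degree is odd. Two uses of the mean value
    theorem reduce it to [1 + w <= expR w], each intermediate point having the sign of the previous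
    one. *)
Lemma expR_ge_cubic (R : realType) (u : R) : 1 + u + u ^+ 2 / 2 + u ^+ 3 / 6 <= expR u.
Proof.
have mvt (f df : R -> R) : f 0 = 0 -> (forall x, is_derive x (1 : R) f (df x)) ->
    forall v, exists2 z, 0 <= z * v & f v = df z * v.
  move=> f0 fdf v.
  have cf (a b : R) : {within `[a, b], continuous f}.
    apply: derivable_within_continuous => x _.
    by have [] := fdf x.
  case: (leP 0 v) => v0.
    have [z] := MVT_segment v0 (fun x _ => fdf x) (cf 0 v).
    rewrite in_itv/= f0 !subr0 => /andP[z0 _] fv.
    by exists z => //; exact: mulr_ge0.
  have [z] := MVT_segment (ltW v0) (fun x _ => fdf x) (cf v 0).
  rewrite in_itv/= f0 !sub0r mulrN => /andP[_ z0] /oppr_inj fv.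
  by exists z => //; rewrite mulr_le0// ltW.
pose h1 (x : R) := expR x - (1 + x).
pose h2 (x : R) := expR x - (1 + x + x ^+ 2 / 2).
pose h3 (x : R) := expR x - (1 + x + x ^+ 2 / 2 + x ^+ 3 / 6).
have d2 x : is_derive x (1 : R) h2 (h1 x).
  rewrite /h2; apply: is_derive_eq; rewrite /h1 /GRing.scale/=; by field.
have d3 x : is_derive x (1 : R) h3 (h2 x).
  rewrite /h3; apply: is_derive_eq; rewrite /h2 /GRing.scale/=; by field.
have h20 : h2 0 = 0 by rewrite /h2 expR0; ring.
have h30 : h3 0 = 0 by rewrite /h3 expR0; ring.
rewrite -subr_ge0 -/(h3 u).
have [z zu ->] := mvt h3 h2 h30 d3 u; have [w _ ->] := mvt h2 h1 h20 d2 z.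
by rewrite -mulrA mulr_ge0// subr_ge0 expR_ge1Dx.
Qed.

Lemma normr_sin_le (R : realType) (x : R) : `|sin x| <= `|x|.
Proof.
wlog x0 : x / 0 <= x.
  move=> H; case: (leP 0 x) => [/H//|x0].
  by rewrite -normrN -sinN -[leRHS]normrN; apply: H; rewrite oppr_ge0 ltW.
have [z _] := MVT_segment x0 (fun z _ => is_derive_sin z)
  (@continuous_subspaceT _ _ _ _ (@continuous_sin R)).
rewrite sin0 !subr0 => ->; rewrite normrM -[leRHS]mul1r ler_wpM2r//.
by rewrite ler_norml cos_geN1 cos_le1.
Qed.

Lemma sin_cos_exists (R : realType) (c s : R) : c ^+ 2 + s ^+ 2 = 1 ->
  exists2 a, cos a = c & sin a = s.
Proof.
move=> cs; have s2 : s ^+ 2 = 1 - c ^+ 2 by rewrite -cs; ring.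
have c1 : -1 <= c <= 1.
  by rewrite -ler_norml -(@expr_le1 _ 2)// real_normK ?num_real// -cs lerDl sqr_ge0.
have ca : cos (acos c) = c by rewrite acosK// in_itv.
have sa : sin (acos c) = `|s| by rewrite sin_acos// -s2 sqrtr_sqr.
case: (leP 0 s) => s0.
  by exists (acos c) => //; rewrite sa ger0_norm.
by exists (- acos c); rewrite ?cosN// sinN sa ltr0_norm// opprK.
Qed.

(** The difference quotient is at most [sqrt (C |h|)], so the derivative is zero everywhere. *)
Lemma cst_of_holder (R : realType) (g : R -> R) (C : R) :
  (forall x h, `|h| <= 1 -> (g (x + h) - g x) ^+ 2 <= C * `|h| ^+ 3) ->
  forall x y, g x = g y.
Proof.
move=> gC x y; apply: is_derive_0_is_cst => {x y} x.
have C0 : 0 <= C.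
  by have := gC 0 1; rewrite normr1 expr1n mulr1 lexx => /(_ isT); apply: le_trans; rewrite sqr_ge0.
have L : (fun h : R => h^-1 *: (g (h *: 1 + x) - g x)) @ 0^' --> (0 : R).
  apply/cvgrPdist_le => e e0; near=> h; rewrite sub0r normrN.
  have h0 : h != 0 by near: h; exact: nbhs_dnbhs_neq.
  have h1 : `|h| <= 1.
    near: h; apply: dnbhs0_le; exact: ltr01.
  have h2 : `|h| <= e ^+ 2 / (C + 1).
    near: h; apply: dnbhs0_le; by rewrite divr_gt0 ?exprn_gt0// ltr_wpDl.
  rewrite (_ : h *: (1 : R) + x = x + h); last by rewrite [_ *: _]mulr1 addrC.
  rewrite normrM normfV ler_pdivrMl ?normr_gt0//.
  rewrite -(@ler_pXn2r _ 2) ?nnegrE ?mulr_ge0 ?(ltW e0)// real_normK ?num_real//.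
  apply: le_trans (gC x h h1) _.
  rewrite exprS mulrA exprMn mulrC ler_wpM2l ?exprn_ge0//.
  move: h2; rewrite ler_pdivlMr ?ltr_wpDl// => h2.
  by apply: le_trans h2; rewrite mulrDr mulr1 mulrC lerDl.
by apply: DeriveDef; [apply/cvg_ex; exists 0|exact: cvg_lim].
Unshelve. all: by end_near. Qed.

Section rotation_kernel.
Context (R : realType) (n : nat) (lambda : R).
Hypothesis lambda_gt0 : 0 < lambda.
Notation V := 'rV[R]_n.

(* [laplace_kernel (dot t x)] is the spherical Laplacian of [expR (lambda * dot t x)]. *)
Definition laplace_kernel (a : R) : R :=
  expR (lambda * a) * (lambda ^+ 2 * (1 - a ^+ 2) - lambda * (n%:R - 1) * a).

(** The term [lambda * n%:R] pays for replacing [2 * (1 - c)] by [s ^+ 2]; the other one collects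
    the remainder of [kernel_term_lower] over at most [n ^ 2] ordered pairs. *)
Definition rot_const : R := expR lambda * (lambda * n%:R + (n ^ 2)%:R * (4 * lambda ^+ 2 + 11 * lambda ^+ 3)).

Lemma sum_neq (f : 'I_n -> 'I_n -> R) :
  \sum_i \sum_(j | j != i) f i j = \sum_i \sum_j f i j - \sum_i f i i.
Proof.
rewrite -sumrB; apply: eq_bigr => i _; rewrite [in RHS](bigD1 i)//=.
by rewrite addrAC subrr add0r.
Qed.

Lemma sum_rot_sym (x y : V) : \sum_i \sum_(j | j != i) (x 0 i * y 0 i + x 0 j * y 0 j) =
  2 * (n%:R - 1) * dot x y.
Proof.
rewrite sum_neq [X in X - _](_ : _ = 2 * n%:R * dot x y); last first.
  transitivity (\sum_i (n%:R * (x 0 i * y 0 i) + dot x y)).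
    by apply: eq_bigr => i _; rewrite big_split/= sumr_const card_ord mulr_natl.
  rewrite big_split/= sumr_const card_ord -mulr_sumr -/(dot x y) -[dot x y *+ n]mulr_natl.
  by ring.
rewrite big_split/= -/(dot x y); ring.
Qed.

Lemma sum_rot_skew (x y : V) : \sum_i \sum_(j | j != i) (x 0 i * y 0 j - x 0 j * y 0 i) = 0.
Proof.
rewrite sum_neq [X in _ - X]big1 => [|i _]; last by rewrite mulrC subrr.
rewrite subr0; under eq_bigr => i _ do rewrite sumrB.
by rewrite sumrB exchange_big/= subrr.
Qed.

(** Lagrange's identity, each unordered pair being counted twice. *)
Lemma sum_rot_skew2 (x y : V) : unit_sphere x -> unit_sphere y ->
  \sum_i \sum_(j | j != i) (x 0 i * y 0 j - x 0 j * y 0 i) ^+ 2 = 2 * (1 - dot x y ^+ 2).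
Proof.
move=> /unit_sphereE x1 /unit_sphereE y1.
rewrite sum_neq [X in _ - X]big1 => [|i _]; last by rewrite mulrC subrr expr0n.
rewrite subr0.
transitivity (\sum_i \sum_j (x 0 i * x 0 i) * (y 0 j * y 0 j)
   + \sum_i \sum_j (y 0 i * y 0 i) * (x 0 j * x 0 j)
   - 2 * \sum_i \sum_j (x 0 i * y 0 i) * (x 0 j * y 0 j)).
  rewrite mulr_sumr -sumrN -!big_split/=; apply: eq_bigr => i _.
  rewrite mulr_sumr -sumrN -!big_split/=; apply: eq_bigr => j _; ring.
rewrite (eq_bigr (fun i => x 0 i * x 0 i * dot y y)); last by move=> i _; rewrite mulr_sumr.
rewrite -mulr_suml -/(dot x x).
rewrite (eq_bigr (fun i => y 0 i * y 0 i * dot x x)); last by move=> i _; rewrite mulr_sumr.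
rewrite -mulr_suml -/(dot y y).
rewrite (eq_bigr (fun i => x 0 i * y 0 i * dot x y)); last by move=> i _; rewrite mulr_sumr.
rewrite -mulr_suml -/(dot x y) x1 y1; ring.
Qed.

End rotation_kernel.

(** With [v = (c - 1) * A + s * B], the cross term of [v ^+ 2] costs [8 |s|^3], which gives
    [4 * lambda ^+ 2]. The cubic term costs [64 |s|^3 / 6], as [|v| <= 4 |s|], and 64/6 is rounded
    up to 11. *)
Lemma kernel_term_lower (R : realType) (lambda a c s A B : R) : 0 < lambda ->
  0 <= c -> c ^+ 2 + s ^+ 2 = 1 -> `|A| <= 2 -> `|B| <= 2 ->
  expR (lambda * a) * (lambda * (c - 1) * A + lambda * s * B
    + lambda ^+ 2 / 2 * s ^+ 2 * B ^+ 2 - (4 * lambda ^+ 2 + 11 * lambda ^+ 3) * `|s| ^+ 3) <=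
  expR (lambda * (a + (c - 1) * A + s * B)) - expR (lambda * a).
Proof.
move=> lambda_gt0 c0 cs A2 B2.
have s1 : `|s| <= 1.
  by rewrite -(@expr_le1 _ 2)// real_normK ?num_real// -cs lerDr sqr_ge0.
have S0 := normr_ge0 s; have S2 : `|s| ^+ 2 = s ^+ 2 by rewrite real_normK ?num_real.
have c1 : c <= 1 by rewrite -(@expr_le1 _ 2)// -cs lerDl sqr_ge0.
have cS : 1 - c <= `|s| ^+ 2.
  have -> : `|s| ^+ 2 = (1 - c) * (1 + c) by rewrite S2 -[LHS](addKr (c ^+ 2)) cs; ring.
  by rewrite ler_peMr ?subr_ge0// lerDl.
pose v := (c - 1) * A + s * B.
rewrite (_ : lambda * (a + (c - 1) * A + s * B) = lambda * a + lambda * v); last by rewrite /v; ring.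
rewrite expRD -[X in _ <= _ - X]mulr1 -mulrBr.
apply: ler_wpM2l; first exact: expR_ge0.
have := expR_ge_cubic (lambda * v).
have cA : `|(c - 1) * A| <= 2 * `|s| ^+ 2.
  have -> : `|(c - 1) * A| = `|A| * (1 - c).
    by rewrite normrM distrC mulrC (ger0_norm (x := 1 - c))// subr_ge0.
  by apply: ler_pM => //; rewrite subr_ge0.
have sB : `|s * B| <= 2 * `|s| by rewrite normrM mulrC ler_wpM2r.
have v4 : `|v| <= 4 * `|s|.
  rewrite (le_trans (ler_normD _ _))// (le_trans (lerD cA sB))//.
  have : `|s| ^+ 2 <= `|s| by rewrite expr2 ler_piMr.
  by lra.
have v3 : - (64 * `|s| ^+ 3) <= v ^+ 3.
  suff : `|v ^+ 3| <= 64 * `|s| ^+ 3 by rewrite ler_norml => /andP[].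
  rewrite normrX (_ : 64 * `|s| ^+ 3 = (4 * `|s|) ^+ 3); last by ring.
  by rewrite ler_pXn2r// nnegrE mulr_ge0.
have cross : - (4 * `|s| ^+ 3) <= (c - 1) * A * (s * B).
  suff : `|(c - 1) * A * (s * B)| <= 4 * `|s| ^+ 3 by rewrite ler_norml => /andP[].
  rewrite normrM (_ : 4 * `|s| ^+ 3 = (2 * `|s| ^+ 2) * (2 * `|s|)); last by ring.
  exact: ler_pM.
have sq : s ^+ 2 * B ^+ 2 - 8 * `|s| ^+ 3 <= v ^+ 2.
  have -> : v ^+ 2 = ((c - 1) * A) ^+ 2 + 2 * ((c - 1) * A * (s * B))
     + s ^+ 2 * B ^+ 2 by rewrite /v; ring.
  by have := sqr_ge0 ((c - 1) * A); move: cross; lra.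
have l2 : lambda ^+ 2 / 2 * (s ^+ 2 * B ^+ 2 - 8 * `|s| ^+ 3) <= lambda ^+ 2 / 2 * v ^+ 2.
  by apply: ler_wpM2l => //; rewrite divr_ge0 ?sqr_ge0.
have l3 : lambda ^+ 3 / 6 * (- (64 * `|s| ^+ 3)) <= lambda ^+ 3 / 6 * v ^+ 3.
  by apply: ler_wpM2l => //; rewrite divr_ge0// exprn_ge0 ?ltW.
have l4 : 0 <= lambda ^+ 3 * `|s| ^+ 3 by rewrite mulr_ge0 ?exprn_ge0// ltW.
have -> : 1 + lambda * v + (lambda * v) ^+ 2 / 2 + (lambda * v) ^+ 3 / 6 =
  1 + lambda * v + lambda ^+ 2 / 2 * v ^+ 2 + lambda ^+ 3 / 6 * v ^+ 3 by field.
rewrite -[lambda * v](_ : lambda * (c - 1) * A + lambda * s * B = _); last by rewrite /v; ring.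
move: l2 l3 l4; lra.
Qed.

Section kernel_rot.
Context (R : realType) (n : nat) (lambda : R).
Hypothesis lambda_gt0 : 0 < lambda.
Notation V := 'rV[R]_n.
Notation laplace_kernel := (laplace_kernel n lambda).
Notation rot_const := (rot_const n lambda).

(* Summed over all coordinate planes, the first-order terms cancel and the
   second-order ones add up to [laplace_kernel]. *)
Lemma kernel_rot_lower (x y : V) (c s : R) : unit_sphere x -> unit_sphere y ->
  0 <= c -> c ^+ 2 + s ^+ 2 = 1 ->
  s ^+ 2 * laplace_kernel (dot x y) - rot_const * `|s| ^+ 3 <=
  \sum_i \sum_(j | j != i)
     (expR (lambda * dot (plane_rot i j c s x) y) - expR (lambda * dot x y)).
Proof.
move=> x1 y1 c0 cs; set a := dot x y.
have a1 : `|a| <= 1 by exact: norm_dot_le1.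
have s1 : `|s| <= 1.
  by rewrite -(@expr_le1 _ 2)// real_normK ?num_real// -cs lerDr sqr_ge0.
have S0 := normr_ge0 s; have S2 : `|s| ^+ 2 = s ^+ 2 by rewrite real_normK ?num_real.
have c1 : c <= 1 by rewrite -(@expr_le1 _ 2)// -cs lerDl sqr_ge0.
have cS : 1 - c <= `|s| ^+ 2.
  have -> : `|s| ^+ 2 = (1 - c) * (1 + c) by rewrite S2 -[LHS](addKr (c ^+ 2)) cs; ring.
  by rewrite ler_peMr ?subr_ge0// lerDl.
pose A i j := x 0 i * y 0 i + x 0 j * y 0 j.
pose B i j := x 0 i * y 0 j - x 0 j * y 0 i.
have xy1 i j : `|x 0 i * y 0 j| <= 1.
  by rewrite normrM -[leRHS]mulr1 ler_pM// norm_coord_le1.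
have A2 i j : `|A i j| <= 2.
  by rewrite (le_trans (ler_normD _ _))//; have := xy1 i i; have := xy1 j j; lra.
have B2 i j : `|B i j| <= 2.
  by rewrite (le_trans (ler_normB _ _))//; have := xy1 i j; have := xy1 j i; lra.
pose low i j := lambda * (c - 1) * A i j + lambda * s * B i j
  + lambda ^+ 2 / 2 * s ^+ 2 * B i j ^+ 2 - (4 * lambda ^+ 2 + 11 * lambda ^+ 3) * `|s| ^+ 3.
have term i j : j != i -> expR (lambda * a) * low i j <=
    expR (lambda * dot (plane_rot i j c s x) y) - expR (lambda * a).
  move=> ji; rewrite dot_plane_rotl 1?eq_sym// -/a -/(A i j) -/(B i j).
  exact: (kernel_term_lower _ lambda_gt0 c0 cs (A2 i j) (B2 i j)).
apply: (@le_trans _ _ (\sum_i \sum_(j | j != i) expR (lambda * a) * low i j)); last first.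
  by apply: ler_sum => i _; apply: ler_sum => j; exact: term.
have -> : \sum_i \sum_(j | j != i) expR (lambda * a) * low i j =
    expR (lambda * a) * (\sum_i \sum_(j | j != i) low i j).
  by rewrite [RHS]mulr_sumr; apply: eq_bigr => i _; rewrite mulr_sumr.
set K3 := (4 * lambda ^+ 2 + 11 * lambda ^+ 3) * `|s| ^+ 3.
have K30 : 0 <= K3.
  by rewrite /K3 mulr_ge0 ?exprn_ge0// addr_ge0// mulr_ge0 ?exprn_ge0// ltW.
have lowE : \sum_i \sum_(j | j != i) low i j = lambda * (c - 1) * (2 * (n%:R - 1) * a)
    + lambda ^+ 2 / 2 * s ^+ 2 * (2 * (1 - a ^+ 2)) - \sum_(i < n) \sum_(j < n | j != i) K3.
  transitivity (lambda * (c - 1) * (\sum_i \sum_(j | j != i) A i j)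
      + lambda * s * (\sum_i \sum_(j | j != i) B i j)
      + lambda ^+ 2 / 2 * s ^+ 2 * (\sum_i \sum_(j | j != i) B i j ^+ 2)
      - \sum_(i < n) \sum_(j < n | j != i) K3).
    rewrite !mulr_sumr -sumrN -!big_split/=; apply: eq_bigr => i _.
    by rewrite !mulr_sumr -sumrN -!big_split.
  by rewrite sum_rot_sym sum_rot_skew sum_rot_skew2// mulr0 addr0.
have sumK : \sum_(i < n) \sum_(j < n | j != i) K3 <= (n ^ 2)%:R * K3.
  rewrite sum_neq !sumr_const card_ord -mulrnA mulnn mulr_natl lerBlDr lerDl.
  exact: mulrn_wge0.
have n0 : 0 <= (n%:R : R) by [].
have e1 : expR (lambda * a) <= expR lambda.
  by rewrite ler_expR -[leRHS]mulr1 ler_pM2l//; apply: le_trans (ler_norm _) a1.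
have [n1|n1] := leqP n 0.
  have /unit_sphereE := x1; rewrite /dot big1 => [/esym/eqP|i _]; first by rewrite oner_eq0.
  by have := ltn_ord i; rewrite ltnNge (leq_trans n1).
have n1R : 1 <= (n%:R : R) by rewrite ler1n.
(* The sums of [A] carry the factor [c - 1] and those of [B ^+ 2] the factor [s ^+ 2]; both are
   brought to [s ^+ 2], the error [(1 - c) ^+ 2] being of order 4. *)
have ce : 2 * (c - 1) = - s ^+ 2 - (1 - c) ^+ 2.
  have -> : s ^+ 2 = 1 - c ^+ 2 by rewrite -cs; ring.
  by ring.
have c4 : (1 - c) ^+ 2 <= `|s| ^+ 3.
  apply: (@le_trans _ _ ((`|s| ^+ 2) ^+ 2)).
    by rewrite ler_pXn2r// nnegrE ?subr_ge0// sqr_ge0.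
  by rewrite -exprM; apply: ler_wiXn2l.
have na : lambda * (n%:R - 1) * a * (1 - c) ^+ 2 <= lambda * n%:R * `|s| ^+ 3.
  apply: le_trans (ler_norm _) _; rewrite normrM [X in _ * X]ger0_norm ?sqr_ge0//.
  apply: ler_pM => //; first exact: sqr_ge0.
  rewrite normrM -[leRHS]mulr1 ler_pM// ger0_norm.
    by rewrite ler_pM2l// gerBl.
  by apply: mulr_ge0; [exact: ltW|rewrite subr_ge0].
apply: (@le_trans _ _ (expR (lambda * a) * (s ^+ 2 * (lambda ^+ 2 * (1 - a ^+ 2) - lambda * (n%:R - 1) * a)
   - (lambda * n%:R * `|s| ^+ 3 + (n ^ 2)%:R * K3)))).
  have -> : s ^+ 2 * laplace_kernel a = expR (lambda * a) *
      (s ^+ 2 * (lambda ^+ 2 * (1 - a ^+ 2) - lambda * (n%:R - 1) * a)).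
    by rewrite /laplace_kernel; ring.
  rewrite [leRHS]mulrBr lerD2l lerN2 /rot_const -[leRHS]mulrA.
  have -> : (lambda * n%:R + (n ^ 2)%:R * (4 * lambda ^+ 2 + 11 * lambda ^+ 3)) * `|s| ^+ 3 =
    lambda * n%:R * `|s| ^+ 3 + (n ^ 2)%:R * K3 by rewrite /K3; ring.
  apply: ler_wpM2r => //; apply: addr_ge0; last exact: mulr_ge0.
  by rewrite !mulr_ge0 ?exprn_ge0// ltW.
apply: ler_wpM2l; first exact: expR_ge0.
rewrite lowE.
have -> : lambda * (c - 1) * (2 * (n%:R - 1) * a) = (2 * (c - 1)) * (lambda * (n%:R - 1) * a) by ring.
rewrite ce; move: na sumK; lra.
Qed.

Variables (E : (V -> R) -> R) (mE : sphere_mean E).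
Hypothesis laplace_transform0 : forall x, unit_sphere x ->
  E (fun y => laplace_kernel (dot x y)) = 0.
Notation phi := (transform lambda E).

Lemma sphere_bounded_laplace_kernel x :
  sphere_bounded (fun y : V => laplace_kernel (dot x y)).
Proof.
apply: sphere_boundedM; first exact: sphere_bounded_kernel.
apply: sphere_boundedD.
  apply: sphere_boundedZ; apply: sphere_boundedD; first exact: sphere_bounded_cst.
  under eq_fun do rewrite -mulN1r.
  by apply: sphere_boundedZ; apply: sphere_boundedX; exact: sphere_bounded_dot.
under eq_fun do rewrite -mulNr.
by apply: sphere_boundedZ; exact: sphere_bounded_dot.
Qed.

Lemma sphere_bounded_phi : sphere_bounded phi.
Proof. exact: sphere_bounded_transform. Qed.

Lemma sphere_bounded_phi_rot i j c s : i != j -> c ^+ 2 + s ^+ 2 = 1 ->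
  sphere_bounded (fun x => phi (plane_rot i j c s x)).
Proof.
have [mf [M fM]] := sphere_bounded_phi; move=> ij cs; split.
  exact: measurableT_comp mf (@measurable_plane_rot _ _ i j c s).
by exists M => x x1; apply: fM; exact: unit_sphere_plane_rot.
Qed.

(* Cauchy-Schwarz between the Dirac mass at [t] and the difference of the two laws;
   in particular the right-hand side is nonnegative. *)
Lemma mean_rot_gap i j c s t : i != j -> c ^+ 2 + s ^+ 2 = 1 -> unit_sphere t ->
  (phi (plane_rot j i c s t) - phi t) ^+ 2 <=
  2 * expR lambda * (E phi - E (fun x => phi (plane_rot i j c s x))).
Proof.
move=> ij cs t1.
have mEr := sphere_mean_plane_rot ij cs mE.
have tr x : transform lambda (fun f => E (f \o plane_rot i j c s)) x = phi (plane_rot j i c s x).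
  by congr E; apply/funext => y /=; rewrite dot_plane_rotC// eq_sym.
have rK x : plane_rot j i c s (plane_rot i j c s x) = x.
  apply/rowP => k; rewrite !mxE !eqxx [j == i]eq_sym (negbTE ij).
  have [->|kj] := eqVneq k j.
    by rewrite -[RHS]mul1r -cs; ring.
  have [->|ki] := eqVneq k i => //.
  by rewrite -[RHS]mul1r -cs; ring.
set delta := _ - _; set gap := _ - _.
have e0 := expR_gt0 lambda.
(* The coefficient of the Dirac mass minimizes the quadratic [s ^+ 2 * expR lambda + 2 * s * delta +
   2 * gap], where [expR lambda] is the squared norm of that mass. The rotated law has the same norm
   as the original one. *)
have := energy_ge0 lambda_gt0 (- delta / expR lambda) (sphere_mean_dirac t1) mEr mE.
have -> : transform lambda (fun f => f t) t = expR lambda.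
  by rewrite /transform; move/unit_sphereE: t1 => ->; rewrite mulr1.
rewrite tr -/delta.
have -> : E (transform lambda (fun f => E (f \o plane_rot i j c s)) \o plane_rot i j c s) = E phi.
  by congr E; apply/funext => x /=; rewrite tr rK.
rewrite -[E (_ \o plane_rot i j c s)]/(E (fun x => phi (plane_rot i j c s x))).
set c0 := E phi; set c1 := E _.
have -> : (- delta / expR lambda) ^+ 2 * expR lambda + c0 + c0 +
  2 * (- delta / expR lambda) * delta - 2 * c1 = 2 * gap - delta ^+ 2 / expR lambda.
  by rewrite /gap -/c0 -/c1; field; rewrite gt_eqF.
by rewrite subr_ge0 ler_pdivrMr// mulrAC.
Qed.

(** A single gap is at most the sum of all gaps, and [kernel_rot_lower], averaged over both
    arguments, bounds that sum once the Laplacian term is zero. *)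
Lemma rot_gap_upper i j c s : i != j -> 0 <= c -> c ^+ 2 + s ^+ 2 = 1 ->
  E phi - E (fun x => phi (plane_rot i j c s x)) <= rot_const * `|s| ^+ 3.
Proof.
move=> ij c0 cs.
pose D k l := E phi - E (fun x => phi (plane_rot k l c s x)).
have [x0 x01] : exists x : V, unit_sphere x.
  by exists (delta_mx 0 i); apply/unit_sphereE; rewrite dot_delta mxE !eqxx.
have D0 k l : k != l -> 0 <= D k l.
  move=> kl; have := mean_rot_gap kl cs x01; rewrite -/(D k l).
  by move=> /(le_trans (sqr_ge0 _)); rewrite pmulr_rge0// mulr_gt0// expR_gt0.
apply: (@le_trans _ _ (\sum_k \sum_(l | l != k) D k l)).
  rewrite (bigD1 i)//= (bigD1 j) 1?eq_sym//= -/(D i j) -addrA lerDl addr_ge0//.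
    by apply: sumr_ge0 => l /andP[li _]; apply: D0; rewrite eq_sym.
  by apply: sumr_ge0 => k _; apply: sumr_ge0 => l lk; apply: D0; rewrite eq_sym.
(* The condition is moved inside the summand because [mean_sum] asks for boundedness at every index,
   and a map with equal indices is no rotation. *)
have bF k l : sphere_bounded (fun x => if l != k then phi (plane_rot k l c s x) - phi x else 0).
  case: (boolP (l != k)) => [lk|_]; last exact: sphere_bounded_cst.
  apply: sphere_boundedD; first by apply: sphere_bounded_phi_rot; rewrite // eq_sym.
  by under eq_fun do rewrite -mulN1r; apply: sphere_boundedZ; exact: sphere_bounded_phi.
have -> : \sum_k \sum_(l | l != k) D k l =
    - E (fun x => \sum_k \sum_l if l != k then phi (plane_rot k l c s x) - phi x else 0).
  rewrite (mean_sum mE); last by move=> k; apply: sphere_bounded_sum => l; exact: bF.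
  rewrite -sumrN; apply: eq_bigr => k _; rewrite (mean_sum mE); last by move=> l; exact: bF.
  rewrite -sumrN big_mkcond; apply: eq_bigr => l _.
  case: ifP => lk; last by rewrite mean_cst// oppr0.
  rewrite (meanB mE); first by rewrite opprB.
  - by apply: sphere_bounded_phi_rot; rewrite // eq_sym.
  - exact: sphere_bounded_phi.
rewrite lerNl -[leLHS](mean_cst mE); apply: mean_le => //.
- exact: sphere_bounded_cst.
- by apply: sphere_bounded_sum => k; apply: sphere_bounded_sum => l; exact: bF.
move=> x x1.
have -> : - (rot_const * `|s| ^+ 3) =
    E (fun y => s ^+ 2 * laplace_kernel (dot x y) - rot_const * `|s| ^+ 3).
  rewrite (meanB mE); last exact: sphere_bounded_cst.
    rewrite (mean_cst mE) (meanZ mE); last exact: sphere_bounded_laplace_kernel.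
    by rewrite laplace_transform0// mulr0 sub0r.
  by apply: sphere_boundedZ; exact: sphere_bounded_laplace_kernel.
have bk k l : sphere_bounded (fun y => if l != k then
    expR (lambda * dot (plane_rot k l c s x) y) - expR (lambda * dot x y) else 0).
  case: (boolP (l != k)) => [lk|_]; last exact: sphere_bounded_cst.
  apply: sphere_boundedD; first exact: sphere_bounded_kernel.
  by under eq_fun do rewrite -mulN1r; apply: sphere_boundedZ; exact: sphere_bounded_kernel.
have -> : \sum_k \sum_l (if l != k then phi (plane_rot k l c s x) - phi x else 0) =
    E (fun y => \sum_k \sum_l if l != k then
      expR (lambda * dot (plane_rot k l c s x) y) - expR (lambda * dot x y) else 0).
  rewrite (mean_sum mE); last by move=> k; apply: sphere_bounded_sum => l; exact: bk.
  apply: eq_bigr => k _; rewrite (mean_sum mE); last by move=> l; exact: bk.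
  apply: eq_bigr => l _; case: ifP => lk; last by rewrite mean_cst.
  by rewrite (meanB mE)//; exact: sphere_bounded_kernel.
apply: mean_le => //.
- apply: sphere_boundedD; last exact: sphere_bounded_cst.
  by apply: sphere_boundedZ; exact: sphere_bounded_laplace_kernel.
- by apply: sphere_bounded_sum => k; apply: sphere_bounded_sum => l; exact: bk.
move=> y y1; apply: le_trans (kernel_rot_lower x1 y1 c0 cs) _.
by rewrite le_eqVlt; apply/orP; left; apply/eqP; apply: eq_bigr => k _; rewrite big_mkcond.
Qed.

Lemma transform_rot_invariant i j c s t : i != j -> c ^+ 2 + s ^+ 2 = 1 -> unit_sphere t ->
  phi (plane_rot i j c s t) = phi t.
Proof.
move=> ij cs t1; have [a ca sa] := sin_cos_exists cs.
pose g (x : R) := phi (plane_rot i j (cos x) (sin x) t).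
suff ga : g a = g 0 by move: ga; rewrite /g ca sa cos0 sin0 plane_rot0.
apply: (@cst_of_holder _ _ (2 * expR lambda * rot_const)) => x h h1.
rewrite /g (addrC x h) plane_rotD//.
set u := plane_rot i j (cos x) (sin x) t.
have u1 : unit_sphere u by apply: unit_sphere_plane_rot => //; exact: cos2Dsin2.
have cs1 := cos2Dsin2 h.
(* This is where the restriction to steps [|h| <= 1 <= pi / 2] is used. *)
have ch : 0 <= cos h.
  apply: cos_ge0_pihalf; have := pihalf_ge1 R.
  by move: h1; rewrite ler_norml => /andP[h1 h2] ?; apply/andP; split; lra.
(* [mean_rot_gap] compares the values at [t] and at its inverse rotation, so it is applied with the
   indices exchanged. *)
rewrite eq_sym in ij.
apply: le_trans (mean_rot_gap ij cs1 u1) _.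
rewrite -[leRHS]mulrA ler_pM2l ?mulr_gt0 ?expR_gt0//.
apply: le_trans (rot_gap_upper ij ch cs1) _.
have C0 : 0 <= rot_const.
  rewrite mulr_ge0 ?expR_ge0// addr_ge0//; first by rewrite mulr_ge0// ltW.
  by rewrite mulr_ge0// addr_ge0// mulr_ge0// exprn_ge0// ltW.
by rewrite ler_wpM2l// ler_pXn2r ?nnegrE// normr_sin_le.
Qed.

End kernel_rot.

(** * The spherical Laplacian of a transform *)

Lemma derive_line (R : realType) (n : nat) (F : 'rV[R]_n -> R) (x v : 'rV[R]_n) (h : R) :
  'D_v F (x + h *: v) = 'D_1 (fun k : R => F (x + k *: v)) h.
Proof.
rewrite /derive; congr (lim (_ @ 0^')); apply/funext => k /=.
rewrite /shift/=; congr (_ *: (F _ - _)).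
by rewrite [k *: (1 : R)]mulr1 scalerDl addrCA.
Qed.

(** A second directional derivative sees [F] only on a line near [x], so a one-variable computation
    on a small interval determines it. *)
Lemma derive2_line (R : realType) (n : nat) (F : 'rV[R]_n -> R) (x v : 'rV[R]_n)
    (g1 : R -> R) (g2 delta : R) : 0 < delta ->
  (forall h, `|h| < delta -> is_derive h (1 : R) (fun k : R => F (x + k *: v)) (g1 h)) ->
  is_derive (0 : R) (1 : R) g1 g2 -> 'D_v ('D_v F) x = g2.
Proof.
move=> d0 Fg1 g12; rewrite -[x in LHS]addr0 -(scale0r v) derive_line.
rewrite -(@derive_val _ _ _ _ _ _ _ g12); apply: near_eq_derive; near=> h.
rewrite derive_line; have hd : `|h| < delta by near: h; exists delta => //= y /=; rewrite sub0r normrN.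
by have Fh := Fg1 h hd; rewrite derive_val.
Unshelve. all: by end_near. Qed.

Lemma lipschitz_of_derive (R : realType) (f df : R -> R) (M delta h k : R) :
  (forall x, `|x| <= delta -> is_derive x (1 : R) f (df x)) ->
  (forall x, `|x| <= delta -> `|df x| <= M) -> `|h| <= delta -> `|k| <= delta ->
  `|f k - f h| <= M * `|k - h|.
Proof.
move=> fdf dfM; wlog hk : h k / h <= k.
  move=> H hd kd; case: (leP h k) => hk; first exact: H.
  by rewrite distrC (distrC k); apply: H => //; exact: ltW.
move=> hd kd.
have mid x : x \in `[h, k] -> `|x| <= delta.
  rewrite in_itv/= => /andP[hx xk]; move: hd kd; rewrite !ler_norml => /andP[? ?] /andP[? ?].
  by apply/andP; split; lra.
have [|z zhk ->] := MVT_segment hk (fun x xhk => fdf x (mid x (subset_itv_oo_cc xhk))).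
  by apply: derivable_within_continuous => x /mid xd; have [] := fdf x xd.
by rewrite normrM ler_wpM2r// dfM// mid.
Qed.

(** Differentiation under the expectation: the mean value theorem dominates the difference quotients
    by [M]. As [mean_cvg] speaks of sequences, the limit is taken along arbitrary sequences tending
    to 0. *)
Lemma is_derive_mean (R : realType) (n : nat) (E : ('rV[R]_n -> R) -> R)
    (G G1 : R -> 'rV[R]_n -> R) (M delta : R) : sphere_mean E ->
  (forall h, `|h| <= delta -> sphere_bounded (G h)) ->
  (forall h, `|h| <= delta -> sphere_bounded (G1 h)) ->
  (forall h z, `|h| <= delta -> unit_sphere z -> is_derive h (1 : R) (G ^~ z) (G1 h z)) ->
  (forall h z, `|h| <= delta -> unit_sphere z -> `|G1 h z| <= M) ->
  forall h, `|h| < delta -> is_derive h (1 : R) (fun k => E (G k)) (E (G1 h)).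
Proof.
move=> mE bG bG1 dG G1M h hd; have hd' := ltW hd.
suff L : (fun k : R => k^-1 *: (E (G (k *: 1 + h)) - E (G h))) @ 0^' --> E (G1 h).
  by apply: DeriveDef; [apply/cvg_ex; eexists; exact: L|exact: cvg_lim].
apply/cvgr_dnbhsP => u [u0 ucvg].
have [N _ uN] : \forall k \near \oo, `|u k + h| <= delta.
  have uh : (fun k => `|u k + h|) @ \oo --> `|0 + h|.
    by apply: cvg_norm; apply: cvgD => //; exact: cvg_cst.
  by apply: (cvgr_le _ uh); rewrite add0r.
(* Dropping the first [N] terms keeps every point [u k + h] within the range of the hypotheses. *)
rewrite -(cvg_shiftn N).
pose f_ k z := (u (k + N)%N)^-1 * (G (u (k + N)%N + h) z - G h z).
have bf k : sphere_bounded (f_ k).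
  apply: sphere_boundedZ; apply: sphere_boundedD; first by apply/bG/uN; exact: leq_addl.
  by under eq_fun do rewrite -mulN1r; apply: sphere_boundedZ; exact: bG.
rewrite (_ : (fun _ => _) = E \o f_); last first.
  apply/funext => k /=; rewrite [_ *: (1 : R)]mulr1 /f_ (meanZ mE).
    by rewrite (meanB mE)//; [apply/bG/uN; exact: leq_addl|exact: bG].
  apply: sphere_boundedD; first by apply/bG/uN; exact: leq_addl.
  by under eq_fun do rewrite -mulN1r; apply: sphere_boundedZ; exact: bG.
apply: (mean_cvg mE (M := M)) => //; first exact: bG1.
- move=> k z z1; rewrite /f_ normrM normfV ler_pdivrMl ?normr_gt0// mulrC.
  rewrite -[X in M * `|X|](addrK h).
  apply: (@lipschitz_of_derive _ (G ^~ z) (G1 ^~ z) M delta) => //.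
  + by move=> x xd; exact: dG.
  + by move=> x xd; exact: G1M.
  + by apply: uN; exact: leq_addl.
- move=> z z1; have [/cvg_ex[l Gl] Gd] := dG h z hd' z1.
  have {Gd} <- : l = G1 h z by rewrite -Gd; apply/esym/cvg_lim.
  have uN0 : (forall k, u (k + N)%N != 0) /\ (fun k => u (k + N)%N) @ \oo --> (0 : R).
    by split=> [k|]; [exact: u0|rewrite (cvg_shiftn N u)].
  move/cvgr_dnbhsP : Gl => Gl; have := Gl (fun k => u (k + N)%N) uN0.
  rewrite [X in X @ _ --> _ -> _](_ : _ = f_ ^~ z)//.
  by apply/funext => k; rewrite /= [_ *: (1 : R)]mulr1.
Qed.

Lemma normrM_le (R : realType) (x y a b : R) : `|x| <= a -> `|y| <= b -> `|x * y| <= a * b.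
Proof. by move=> xa yb; rewrite normrM ler_pM. Qed.

(** * The kernel along a coordinate line projected to the sphere *)

Section ray.
Context (R : realType) (tau : R).
Hypothesis tau1 : `|tau| <= 1.

(* At [y = x + h *: e_i] with [|x| = 1], [tau = x_i], [a = dot x z] and [b = z_i], one has
   [rayq h = |y|^2], [rayw a b h = dot (y / |y|) z] and [rayG a b h = expR (lambda * rayw a b h)];
   the suffixes 1 and 2 denote derivatives in [h]. *)
Definition rayq (h : R) := 1 + 2 * tau * h + h ^+ 2.
Definition rayr (h : R) := (Num.sqrt (rayq h))^-1.
Definition rayw (a b h : R) := (a + h * b) * rayr h.
Definition rayw1 (a b h : R) := b * rayr h - (a + h * b) * (tau + h) * rayr h ^+ 3.
Definition rayw2 (a b h : R) := - 2 * b * (tau + h) * rayr h ^+ 3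
  - (a + h * b) * rayr h ^+ 3 + 3 * (a + h * b) * (tau + h) ^+ 2 * rayr h ^+ 5.

(** The line stays at distance at least [1 - |h|] from the origin, where the radial projection is
    singular. *)
Lemma rayq_ge h : `|h| <= 1 / 2 -> 1 / 4 <= rayq h.
Proof.
move=> h2; apply: (@le_trans _ _ ((1 - `|h|) ^+ 2)).
  by have := normr_ge0 h; nra.
have hh : h ^+ 2 = `|h| ^+ 2 by rewrite real_normK ?num_real.
have : - `|h| <= tau * h.
  suff : `|tau * h| <= `|h| by rewrite ler_norml => /andP[].
  by rewrite normrM -[leRHS]mul1r ler_wpM2r.
by rewrite /rayq hh; nra.
Qed.

Lemma rayr_ge0 h : 0 <= rayr h.
Proof. by rewrite invr_ge0 sqrtr_ge0. Qed.

Lemma rayr_le2 h : `|h| <= 1 / 2 -> rayr h <= 2.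
Proof.
move=> /rayq_ge q4; have s12 : 1 / 2 <= Num.sqrt (rayq h).
  have h0 : 0 <= 1 / 2 :> R by lra.
  have q0 : 0 <= rayq h by lra.
  rewrite -(@ler_pXn2r _ 2) ?nnegrE ?sqrtr_ge0// sqr_sqrtr//; lra.
rewrite /rayr -[leRHS]invrK lef_pV2 ?posrE; lra.
Qed.

Lemma is_derive_rayr h : `|h| <= 1 / 2 ->
  is_derive h (1 : R) rayr (- (tau + h) * rayr h ^+ 3).
Proof.
move=> /rayq_ge q4; have q0 : 0 < rayq h by lra.
have dq : is_derive h (1 : R) rayq (2 * (tau + h)).
  by rewrite /rayq; apply: is_derive_eq; rewrite /GRing.scale/=; ring.
have s0 : Num.sqrt (rayq h) != 0 by rewrite gt_eqF// sqrtr_gt0.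
have ds := is_derive1_comp (is_derive1_sqrt q0) dq.
have dr : is_derive h (1 : R) rayr _ := @is_deriveV _ (Num.sqrt \o rayq) _ _ _ s0 ds.
apply: (is_derive_eq dr).
by rewrite /rayr /GRing.scale/=; field.
Qed.

Lemma is_derive_rayw a b h : `|h| <= 1 / 2 -> is_derive h (1 : R) (rayw a b) (rayw1 a b h).
Proof.
move=> h2; have dr := is_derive_rayr h2.
by rewrite /rayw; apply: is_derive_eq; rewrite /rayw1 /GRing.scale/=; ring.
Qed.

Lemma is_derive_rayw1 a b h : `|h| <= 1 / 2 -> is_derive h (1 : R) (rayw1 a b) (rayw2 a b h).
Proof.
move=> h2; have dr := is_derive_rayr h2.
by rewrite /rayw1; apply: is_derive_eq; rewrite /rayw2 /GRing.scale/=; ring.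
Qed.

Variable lambda : R.
Definition rayG (a b h : R) := expR (lambda * rayw a b h).
Definition rayG1 (a b h : R) := lambda * rayw1 a b h * rayG a b h.
Definition rayG2 (a b h : R) :=
  (lambda * rayw2 a b h + (lambda * rayw1 a b h) ^+ 2) * rayG a b h.

Lemma is_derive_rayG a b h : `|h| <= 1 / 2 -> is_derive h (1 : R) (rayG a b) (rayG1 a b h).
Proof.
move=> h2; have dw := is_derive_rayw a b h2.
have dl : is_derive h (1 : R) (fun h => lambda * rayw a b h) (lambda * rayw1 a b h).
  by apply: is_derive_eq; rewrite /GRing.scale/=; ring.
have dG : is_derive h (1 : R) (rayG a b) _ :=
  @is_derive1_comp _ expR (fun k => lambda * rayw a b k) h _ _ (is_derive_expR _) dl.
by apply: (is_derive_eq dG); rewrite /rayG1 /rayG mulrC.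
Qed.

Lemma is_derive_rayG1 a b h : `|h| <= 1 / 2 -> is_derive h (1 : R) (rayG1 a b) (rayG2 a b h).
Proof.
move=> h2; have dw := is_derive_rayw1 a b h2; have dG := is_derive_rayG a b h2.
by rewrite /rayG1; apply: is_derive_eq; rewrite /rayG2 /rayG1 /GRing.scale/=; ring.
Qed.

Section bounds.
Variables (a b h : R).
Hypotheses (a1 : `|a| <= 1) (b1 : `|b| <= 1) (h2 : `|h| <= 1 / 2).

Let r0 := rayr_ge0 h.
Let r2 : `|rayr h| <= 2. Proof. by rewrite ger0_norm// rayr_le2. Qed.
Let ab : `|a + h * b| <= 2.
Proof.
apply: (@le_trans _ _ (1 + 1 / 2 * 1)); last by lra.
by apply: (le_trans (ler_normD _ _)); apply: lerD => //; exact: normrM_le.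
Qed.
Let th : `|tau + h| <= 2.
Proof.
apply: (@le_trans _ _ (1 + 1 / 2)); last by lra.
by apply: (le_trans (ler_normD _ _)); exact: lerD.
Qed.
Let rX k : `|rayr h ^+ k| <= 2 ^+ k.
Proof. by rewrite normrX lerXn2r ?nnegrE. Qed.

(** The constants here and below are crude products of the bounds by 2 above; what matters is
    uniformity in [a], [b] and [h], for dominated convergence. *)
Lemma rayw_bound : `|rayw a b h| <= 4.
Proof.
rewrite (_ : 4 = 2 * 2 :> R); first exact: normrM_le.
by ring.
Qed.

Lemma rayw1_bound : `|rayw1 a b h| <= 34.
Proof.
rewrite (_ : 34 = 1 * 2 + 2 * 2 * 2 ^+ 3 :> R); last by ring.
apply: (le_trans (ler_normB _ _)); apply: lerD; first exact: normrM_le.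
by apply: normrM_le => //; exact: normrM_le.
Qed.

Lemma rayw2_bound : `|rayw2 a b h| <= 816.
Proof.
rewrite (_ : 816 = 2 * 1 * 2 * 2 ^+ 3 + 2 * 2 ^+ 3 + 3 * 2 * 2 ^+ 2 * 2 ^+ 5 :> R); last by ring.
have n2 : `|-2| <= 2 :> R by rewrite normrN ger0_norm.
have n3 : `|3| <= 3 :> R by rewrite ger0_norm.
have th2 : `|(tau + h) ^+ 2| <= 2 ^+ 2 by rewrite normrX lerXn2r ?nnegrE.
apply: (le_trans (ler_normD _ _)); apply: lerD; last first.
  by apply: normrM_le => //; apply: normrM_le => //; exact: normrM_le.
apply: (le_trans (ler_normB _ _)); apply: lerD; last exact: normrM_le.
by apply: normrM_le => //; apply: normrM_le => //; exact: normrM_le.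
Qed.

Lemma rayG_bound : `|rayG a b h| <= expR (`|lambda| * 4).
Proof.
rewrite ger0_norm ?expR_ge0// ler_expR; apply: le_trans (ler_norm _) _.
by rewrite normrM ler_wpM2l// rayw_bound.
Qed.

Lemma rayG1_bound : `|rayG1 a b h| <= `|lambda| * 34 * expR (`|lambda| * 4).
Proof.
apply: normrM_le; last exact: rayG_bound.
by apply: normrM_le => //; exact: rayw1_bound.
Qed.

Lemma rayG2_bound : `|rayG2 a b h| <=
  (`|lambda| * 816 + (`|lambda| * 34) ^+ 2) * expR (`|lambda| * 4).
Proof.
apply: normrM_le; last exact: rayG_bound.
apply: (le_trans (ler_normD _ _)); apply: lerD.
  by apply: normrM_le => //; exact: rayw2_bound.
rewrite normrX lerXn2r ?nnegrE ?mulr_ge0//.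
by apply: normrM_le => //; exact: rayw1_bound.
Qed.

End bounds.

Lemma rayr0 : rayr 0 = 1.
Proof. by rewrite /rayr /rayq mulr0 expr0n !addr0 sqrtr1 invr1. Qed.

Lemma rayG2_0 a b : rayG2 a b 0 = expR (lambda * a) *
  (lambda * (- 2 * (b * tau) - a + 3 * a * tau ^+ 2) + lambda ^+ 2 * (b - a * tau) ^+ 2).
Proof.
rewrite /rayG2 /rayG /rayw /rayw1 /rayw2 rayr0 !mul0r !addr0 !expr1n !mulr1; ring.
Qed.

End ray.

Lemma laplace_beltrami_transform (R : realType) (n : nat) (lambda : R)
    (E : ('rV[R]_n -> R) -> R) (x : 'rV[R]_n) : sphere_mean E -> unit_sphere x ->
  laplace_beltrami (transform lambda E) x = E (fun y => laplace_kernel n lambda (dot x y)).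
Proof.
move=> mE x1; have xx : dot x x = 1 by apply/unit_sphereE.
pose a (z : 'rV[R]_n) := dot x z.
have ba : sphere_bounded a by exact: sphere_bounded_dot.
have bb i : sphere_bounded (fun z : 'rV[R]_n => z 0 i) by exact: sphere_bounded_coord.
have bab i h : sphere_bounded (fun z => a z + h * z 0 i).
  by apply: sphere_boundedD => //; exact: sphere_boundedZ.
have mulC c f : @sphere_bounded R n f -> sphere_bounded (fun z => f z * c).
  by move=> bf; under eq_fun do rewrite mulrC; exact: sphere_boundedZ.
have bN f : @sphere_bounded R n f -> sphere_bounded (fun z => - f z).
  by move=> bf; under eq_fun do rewrite -mulN1r; exact: sphere_boundedZ.
have bw1 i h : sphere_bounded (fun z => rayw1 (x 0 i) (a z) (z 0 i) h).
  rewrite /rayw1; apply: sphere_boundedD; first exact: mulC.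
  by apply/bN/mulC/mulC.
have bw2 i h : sphere_bounded (fun z => rayw2 (x 0 i) (a z) (z 0 i) h).
  rewrite /rayw2; apply: sphere_boundedD.
    apply: sphere_boundedD; first by apply/mulC/mulC/sphere_boundedZ.
    by apply/bN/mulC.
  by apply/mulC/mulC/sphere_boundedZ.
have bG i h : sphere_bounded (fun z => rayG (x 0 i) lambda (a z) (z 0 i) h).
  by apply: sphere_bounded_expR; apply: sphere_boundedZ; exact: mulC.
have bG1 i h : sphere_bounded (fun z => rayG1 (x 0 i) lambda (a z) (z 0 i) h).
  by apply: sphere_boundedM => //; exact: sphere_boundedZ.
have bG2 i h : sphere_bounded (fun z => rayG2 (x 0 i) lambda (a z) (z 0 i) h).
  apply: sphere_boundedM => //; apply: sphere_boundedD; first exact: sphere_boundedZ.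
  by apply: sphere_boundedX; exact: sphere_boundedZ.
have xi i : `|x 0 i| <= 1 by exact: norm_coord_le1.
have lapl i : 'D_(delta_mx 0 i) ('D_(delta_mx 0 i)
    (fun y => transform lambda E ((enorm y)^-1 *: y))) x =
    E (fun z => rayG2 (x 0 i) lambda (a z) (z 0 i) 0).
  have h12 : 0 < 1 / 2 :> R by lra.
  apply: (@derive2_line _ _ _ _ _ (fun h => E (fun z => rayG1 (x 0 i) lambda (a z) (z 0 i) h))
     _ (1 / 2)) => //.
    move=> h hd.
    have -> : (fun k : R => transform lambda E ((enorm (x + k *: delta_mx 0 i))^-1 *:
        (x + k *: delta_mx 0 i))) = fun k => E (fun z => rayG (x 0 i) lambda (a z) (z 0 i) k).
      apply/funext => k; congr E; apply/funext => z.
      have d1 : dot (x + k *: delta_mx 0 i) z = a z + k * z 0 i.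
        by rewrite dotDl dotZl [dot (delta_mx _ _) z]dotC dot_delta.
      have d2 : dot (x + k *: delta_mx 0 i) (x + k *: delta_mx 0 i) = rayq (x 0 i) k.
        rewrite dotDl !dotDr !dotZl !dotZr xx [dot (delta_mx _ _) x]dotC !dot_delta mxE !eqxx.
        by rewrite /rayq /= mulr1n; ring.
      by rewrite dotZl /enorm d1 d2 [_^-1 * _]mulrC.
    apply: (@is_derive_mean _ _ E (fun k z => rayG (x 0 i) lambda (a z) (z 0 i) k)
      (fun k z => rayG1 (x 0 i) lambda (a z) (z 0 i) k)
      (`|lambda| * 34 * expR (`|lambda| * 4)) (1 / 2)) => //.
      by move=> k z kd z1; apply: is_derive_rayG.
    by move=> k z kd z1; apply: rayG1_bound => //; [exact: norm_dot_le1|exact: norm_coord_le1].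
  apply: (@is_derive_mean _ _ E (fun k z => rayG1 (x 0 i) lambda (a z) (z 0 i) k)
    (fun k z => rayG2 (x 0 i) lambda (a z) (z 0 i) k)
    ((`|lambda| * 816 + (`|lambda| * 34) ^+ 2) * expR (`|lambda| * 4))
    (1 / 2)) => //.
  - by move=> k z kd z1; apply: is_derive_rayG1.
  - by move=> k z kd z1; apply: rayG2_bound => //; [exact: norm_dot_le1|exact: norm_coord_le1].
  - by rewrite normr0.
rewrite /laplace_beltrami /laplacian (eq_bigr _ (fun i _ => lapl i)) -mean_sum//.
apply: (mean_eq mE).
- exact: sphere_bounded_sum.
- exact: sphere_bounded_laplace_kernel.
move=> z /unit_sphereE zz; rewrite (eq_bigr _ (fun i _ => rayG2_0 _ _ _ _)) -mulr_sumr.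
rewrite /laplace_kernel -/(a z); congr (_ * _).
(* Summing [rayG2_0] over the coordinates yields this expression, which becomes [laplace_kernel]
   once [dot x x] and [dot z z] are replaced by 1. *)
transitivity (lambda * (- 2 * dot x z - n%:R * a z + 3 * a z * dot x x) +
   lambda ^+ 2 * (dot z z - 2 * a z * dot x z + a z ^+ 2 * dot x x)); last first.
  by rewrite xx zz -/(a z); ring.
(* Abstracting [a z] keeps it a scalar while the other inner products are expanded into sums. *)
generalize (a z) => az.
rewrite (_ : n%:R * az = \sum_(i < n) az); last by rewrite sumr_const card_ord mulr_natl.
rewrite /dot !mulr_sumr -!sumrN -!big_split/= !mulr_sumr -!big_split/=.
by apply: eq_bigr => i _; ring.
Qed.

(** * The theorem *)

Lemma laplace_beltrami_cst (R : realType) (n : nat) (f : 'rV[R]_n -> R) (c : R)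
    (x : 'rV[R]_n) : (forall y, unit_sphere y -> f y = c) -> unit_sphere x ->
  laplace_beltrami f x = 0.
Proof.
move=> fc x1; rewrite /laplace_beltrami /laplacian big1// => i _.
apply: (@derive2_line _ _ _ _ _ (fun=> 0) 0 (1 / 2)); first by lra.
  move=> h hd; apply: (near_eq_is_derive (f := fun=> c)).
  (* The projected function is constant only off the origin, which the line through the unit vector
     [x] cannot meet for [|k| < 1]. *)
  near=> k; have k1 : `|k| < 1.
    near: k; exists (1 - `|h|) => /=; first by lra.
    move=> y /= hy; have := ler_normB h (h - y); rewrite opprB addrC subrK; lra.
  rewrite fc//; apply: unit_sphere_normalize; apply: contraTneq k1 => xk.
  have /unit_sphereE := x1; rewrite (_ : x = - k *: delta_mx 0 i); last first.
    by apply/eqP; rewrite scaleNr -addr_eq0 xk.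
  rewrite dotZl dotZr dot_delta mxE !eqxx mulr1 mulrNN => kk.
  by rewrite -leNgt -(@expr_ge1 _ 2)// real_normK ?num_real// expr2 kk.
Unshelve. all: by end_near. Qed.

Lemma expectation_transform (R : realType) (n : nat) d (T : measurableType d)
    (P : probability T R) (X : {mfun T >-> 'rV[R]_n}) (f : 'rV[R]_n -> R) :
  (forall w, unit_sphere (X w)) -> sphere_bounded f ->
  'E_P[f \o X]%E = (\int[P]_w f (X w))%:E.
Proof.
move=> X1 bf; rewrite unlock /Rintegral fineK//.
by apply: integrable_fin_num => //; exact: integrable_sphere_bounded.
Qed.

Lemma distribution_mean (R : realType) (n : nat) d (T : measurableType d)
    (P : probability T R) (X : {mfun T >-> 'rV[R]_n}) (A : set 'rV[R]_n) : measurable A ->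
  distribution P X A = (\int[P]_w \1_A (X w))%:E.
Proof.
move=> mA; rewrite /Rintegral; have mXA : measurable (X @^-1` A).
  by rewrite -[X in measurable X]setTI; exact: measurable_funP.
rewrite (eq_integral (fun w => (\1_(X @^-1` A) w)%:E))//.
by rewrite integral_indic// setIT fineK// fin_num_measure.
Qed.

Lemma eq_mean_distribution (R : realType) (n : nat) d d' (T : measurableType d)
    (T' : measurableType d') (P : probability T R) (Q : probability T' R)
    (X : {mfun T >-> 'rV[R]_n}) (Y : {mfun T' >-> 'rV[R]_n}) (f : 'rV[R]_n -> R) :
  (forall w, unit_sphere (X w)) -> (forall w, unit_sphere (Y w)) -> sphere_bounded f ->
  (forall A, measurable A -> distribution P X A = distribution Q Y A) ->
  \int[P]_w f (X w) = \int[Q]_w f (Y w).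
Proof.
move=> X1 Y1 bf XY; rewrite /Rintegral; congr fine.
have mEf : measurable_fun setT (EFin \o f) by apply/measurable_EFinP; case: bf.
rewrite -[LHS](@integral_distribution _ _ _ _ R P X (EFin \o f))//; last first.
  exact: integrable_sphere_bounded.
rewrite -[RHS](@integral_distribution _ _ _ _ R Q Y (EFin \o f))//; last first.
  exact: integrable_sphere_bounded.
by apply: eq_measure_integral => A mA _; exact: XY.
Qed.

Lemma transform_mean_cst (R : realType) (n : nat) (lambda : R)
    (E : ('rV[R]_n.+2 -> R) -> R) : 0 < lambda -> sphere_mean E ->
  (forall x, unit_sphere x -> E (fun y => laplace_kernel n.+2 lambda (dot x y)) = 0) ->
  forall t u, unit_sphere t -> unit_sphere u -> transform lambda E t = transform lambda E u.
Proof.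
move=> l0 mE E0; apply: plane_rot_invariant_cst => j c s t j0 cs t1.
by apply: transform_rot_invariant => //; rewrite eq_sym.
Qed.

Lemma transform_uniform_cst (R : realType) (n : nat) (lambda : R) d (T : measurableType d)
    (P : probability T R) (Y : {RV P >-> 'rV[R]_n.+2}) :
  (forall w, unit_sphere (Y w)) -> uniform_on_sphere Y ->
  forall t u, unit_sphere t -> unit_sphere u ->
    transform lambda (fun f => \int[P]_w f (Y w)) t =
    transform lambda (fun f => \int[P]_w f (Y w)) u.
Proof.
move=> Y1 Yunif; apply: plane_rot_invariant_cst => j c s t j0 cs t1.
have j0' : 0 != j by rewrite eq_sym.
have mR := @measurable_plane_rot R n.+2 j 0 c s.
have mRY : measurable_fun setT (plane_rot j 0 c s \o Y) by exact: measurableT_comp.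
pose Z : {mfun T >-> 'rV[R]_n.+2} :=
  HB.pack (plane_rot j 0 c s \o Y) (isMeasurableFun.Build _ _ _ _ _ mRY).
have Z1 w : unit_sphere (Z w) by apply: unit_sphere_plane_rot.
(* The transpose has the index 0 in second place; a change of sign of [s] brings it back to the form
   of [surface_measure_plane_rot]. *)
have rotN : plane_rot j 0 c s = plane_rot 0 j c (- s) :> ('rV[R]_n.+2 -> _).
  apply/funext => x; apply/rowP => k; rewrite !mxE.
  have [->|kj] := eqVneq k j; first by rewrite (negbTE j0); ring.
  by case: ifP => // _; ring.
rewrite /transform -[RHS](@eq_mean_distribution _ _ _ _ _ _ P P Z Y
  (fun y => expR (lambda * dot t y)))//.
- by apply: eq_Rintegral => w _; rewrite dot_plane_rotC.
- exact: sphere_bounded_kernel.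
- move=> A mA; rewrite -[LHS]/(distribution P Y (plane_rot j 0 c s @^-1` A)).
  have mRA : measurable (plane_rot j 0 c s @^-1` A).
    by rewrite -[X in measurable X]setTI; exact: mR.
  rewrite [LHS](Yunif _ mRA) [RHS](Yunif _ mA).
  by rewrite rotN surface_measure_plane_rot// sqrrN.
Qed.

Theorem proposition1p1 (R : realType) (p : nat) (hp : (2 <= p)%N)
    (lambda : R) (hlambda : 0 < lambda)
    (d : measure_display) (T : measurableType d) (P : probability T R)
    (X : {RV P >-> 'rV[R]_p}) (hX : forall w : T, unit_sphere (X w)) :
  (forall t : 'rV[R]_p, unit_sphere t ->
     'E_P[fun w => laplace_beltrami
                     (fun x : 'rV[R]_p => expR (lambda * dot t x)) (X w)]%E
       = (laplace_beltrami
            (fun s : 'rV[R]_p => fine (mgf X (lambda *: s))) t)%:E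
     /\ laplace_beltrami
          (fun s : 'rV[R]_p => fine (mgf X (lambda *: s))) t = 0)
  <-> uniform_on_sphere X.
Proof.
case: p hp X hX => [|[|n]]// _ X hX.
pose E (f : 'rV[R]_n.+2 -> R) := \int[P]_w f (X w).
have mE : sphere_mean E by exact: sphere_mean_RV.
have mgfE : (fun s => fine (mgf X (lambda *: s))) = transform lambda E.
  apply/funext => s; rewrite /mgf unlock /transform /E /Rintegral; congr fine.
  by apply: eq_integral => w _; rewrite dotZl.
have lapE t : unit_sphere t ->
    'E_P[fun w => laplace_beltrami (fun x => expR (lambda * dot t x)) (X w)]%E =
    (E (fun x => laplace_kernel n.+2 lambda (dot t x)))%:E.
  move=> t1; rewrite -expectation_transform//; last exact: sphere_bounded_laplace_kernel.
  congr expectation; apply/funext => w /=.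
  (* As a function of [x], the exponential is the transform of the Dirac mass at [t], so one lemma
     computes both Laplacians. *)
  rewrite (_ : (fun x => _) = transform lambda (fun f => f t)); last first.
    by apply/funext => x; rewrite /transform dotC.
  by rewrite laplace_beltrami_transform ?(dotC t)//; exact: sphere_mean_dirac.
have lap t : unit_sphere t -> laplace_beltrami (transform lambda E) t =
    E (fun x => laplace_kernel n.+2 lambda (dot t x)).
  exact: laplace_beltrami_transform.
have [e e1] : exists e : 'rV[R]_n.+2, unit_sphere e.
  by exists (delta_mx 0 0); apply/unit_sphereE; rewrite dot_delta mxE eqxx.
rewrite mgfE; split=> [h|Xunif t t1].
  have Ecst := transform_mean_cst hlambda mE (fun t t1 => etrans (esym (lap t t1)) (h t t1).2).
  have [d' [T' [Q [Y [Y1 Yunif]]]]] := uniform_on_sphere_exists R n.+1.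
  have mF := @sphere_mean_RV _ _ _ _ Q Y Y1; have Fcst := transform_uniform_cst lambda Y1 Yunif.
  have EF := eq_mean_monomial hlambda mE mF (fun x x1 => Ecst x e x1 e1)
    (fun x x1 => Fcst x e x1 e1).
  move=> A mA; rewrite -Yunif// !distribution_mean//; congr EFin.
  exact: (eq_mean_indic mE mF EF mA).
have lap0 : laplace_beltrami (transform lambda E) t = 0.
  apply: (@laplace_beltrami_cst _ _ _ (transform lambda E e)) => // y y1.
  exact: transform_uniform_cst.
by rewrite lapE// -(lap t t1).
Qed.
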